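(* Let $d\ge 2$, $1\le m<d$, $n\ge 1$ be integers, and let $\nu\ge 0$, $c>0$, $t>0$ be real. Let $\underline{\mathbf X}_m^d(t)=(X_1(t),\dots,X_m(t))$ be the projection onto $\mathbb{R}^m$ of the random flight in $\mathbb{R}^d$ with parameter $\nu$, speed $c$ and $n$ changes of direction in $[0,t]$ (as defined in the context). Then the law of $\underline{\mathbf X}_m^d(t)$, which is concentrated in the ball $\{\underline{\mathbf x}_m\in\mathbb{R}^m:\|\underline{\mathbf x}_m\|<ct\}$, has density with respect to Lebesgue measure on $\mathbb{R}^m$ equal to $$p_{n,d}^\nu(\underline{\mathbf x}_m,t)=\frac{\Gamma\!\left(\frac{n+1}{2}(2\nu+d-1)+\frac12\right)}{\Gamma\!\left(\frac{n+1}{2}(2\nu+d-1)-\frac m2+\frac12\right)}\;\frac{(c^2t^2-\|\underline{\mathbf x}_m\|^2)^{\frac{n+1}{2}(2\nu+d-1)-\frac{m+1}{2}}}{\pi^{m/2}(ct)^{(n+1)(2\nu+d-1)-1}},\qquad \|\underline{\mathbf x}_m\|<ct.$$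
   Context: Here $\|\cdot\|$ is the Euclidean norm. Random flight. A particle starts at the origin of $\mathbb{R}^d$, moves with constant speed $c>0$, and changes direction exactly $n$ times in $[0,t]$. The durations of the $n+1$ straight segments are $\tau_1,\dots,\tau_{n+1}>0$ with $\tau_{n+1}=t-\sum_{j=1}^n\tau_j$, and $(\tau_1,\dots,\tau_n)$ has the rescaled Dirichlet density $$f_{d,\nu}(\tau_1,\dots,\tau_n)=\frac{\Gamma((n+1)(2\nu+d-1))}{(\Gamma(2\nu+d-1))^{n+1}}\,\frac{\prod_{k=1}^{n+1}\tau_k^{2\nu+d-2}}{t^{(n+1)(2\nu+d-1)-1}}$$ on $\{\tau_j>0\ (1\le j\le n),\ \sum_{j=1}^n\tau_j<t\}$. The angle vectors $(\theta_{1,k},\dots,\theta_{d-2,k},\phi_k)$, $k=1,\dots,n+1$, are independent of each other and of the times, and each has density $$g_{d,\nu}(\theta_1,\dots,\theta_{d-2},\phi)=\frac{\Gamma(\nu+d/2)}{2\pi^{\frac{d-1}{2}}\Gamma(\nu+1/2)}\sin^{2\nu+d-2}\theta_1\,\sin^{2\nu+d-3}\theta_2\cdots\sin^{2\nu+1}\theta_{d-2}\,|\sin\phi|^{2\nu}$$ on $\theta_j\in[0,\pi]$ $(1\le j\le d-2)$, $\phi\in[0,2\pi]$ (for $d=2$ there is only the angle $\phi$). The projection $\underline{\mathbf X}_m^d(t)=(X_1(t),\dots,X_m(t))$, $1\le m<d$, consists of the first $m$ coordinates of the particle's position at time $t$, namely, with the convention $\theta_{d-1,k}=\phi_k$, $$X_i(t)=c\sum_{k=1}^{n+1}\tau_k\,\sin\theta_{1,k}\cdots\sin\theta_{i-1,k}\,\cos\theta_{i,k},\qquad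 1\le i\le m$$ (so $X_1(t)=c\sum_{k=1}^{n+1}\tau_k\cos\theta_{1,k}$). *)

(* Defs.v *)
From HB Require Import structures.
From mathcomp Require Import all_boot all_order all_algebra.
From mathcomp Require Import all_classical all_reals all_analysis.
From mathcomp Require Import measurable_realfun.

Set Implicit Arguments.
Unset Strict Implicit.
Unset Printing Implicit Defensive.

Import Order.TTheory GRing.Theory Num.Theory.
Import numFieldNormedType.Exports.

Local Open Scope classical_set_scope.
Local Open Scope ring_scope.

Section lebesgue_tuple.
Context {R : realType}.
Local Notation mR := (measurableTypeR R).

Definition cons_pair n (p : mR * n.-tuple mR) : n.+1.-tuple mR :=
  [tuple of p.1 :: p.2].

Lemma measurable_cons_pair n :
  measurable_fun [set: mR * n.-tuple mR] (@cons_pair n).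
Proof. exact: measurable_cons. Qed.

HB.instance Definition _ n :=
  isMeasurableFun.Build _ _ _ _ (@cons_pair n) (@measurable_cons_pair n).

Section step.
Context (n : nat) (mu : {sigma_finite_measure set (n.-tuple mR) -> \bar R}).

Definition lebesgue_tuple_step : set (n.+1.-tuple mR) -> \bar R :=
  pushforward (lebesgue_measure \x mu)%E (@cons_pair n).

Let step0 : lebesgue_tuple_step set0 = 0%E.
Proof. exact: measure0. Qed.

Let step_ge0 A : (0 <= lebesgue_tuple_step A)%E.
Proof. exact: measure_ge0. Qed.

Let step_sigma_additive : semi_sigma_additive lebesgue_tuple_step.
Proof. exact: measure_semi_sigma_additive. Qed.

HB.instance Definition _ := isMeasure.Build _ _ _ lebesgue_tuple_step
  step0 step_ge0 step_sigma_additive.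

Let step_sigma_finite : sigma_finite setT lebesgue_tuple_step.
Proof.
have /sigma_finiteP[F [TF ndF Foo]] := sigma_finiteT (@lebesgue_measure R).
have /sigma_finiteP[G [TG ndG Goo]] := sigma_finiteT mu.
pose u (x : n.+1.-tuple mR) : mR * n.-tuple mR := (thead x, [tuple of behead x]).
have uK : cancel (@cons_pair n) u.
  by move=> -[a b]; rewrite /u /cons_pair theadE; congr (_, _); exact: val_inj.
have mu_ : measurable_fun setT u.
  apply: measurable_fun_pair; first exact: (@measurable_tnth _ _ _ ord0).
  exact: measurable_behead.
exists (fun i => u @^-1` (F i `*` G i)).
  apply/esym/seteqP; split=> // x _.
  have [[i _ Fi] [j _ Gj]] : (\bigcup_i F i) (u x).1 /\ (\bigcup_i G i) (u x).2.
    by rewrite -TF -TG.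
  exists (maxn i j) => //; split.
    by move: Fi; exact/subsetPset/ndF/leq_maxl.
  by move: Gj; exact/subsetPset/ndG/leq_maxr.
move=> i; have [mFi Fioo] := Foo i; have [mGi Gioo] := Goo i; split.
  by rewrite -[X in measurable X]setTI; apply: mu_ => //; exact: measurableX.
rewrite /lebesgue_tuple_step /pushforward -comp_preimage.
rewrite (_ : u \o _ = id); last by apply/funext => x /=; exact: uK.
by rewrite preimage_id product_measure1E// lte_mul_pinfty// ge0_fin_numE.
Qed.

HB.instance Definition _ := Measure_isSigmaFinite.Build _ _ _
  lebesgue_tuple_step step_sigma_finite.

End step.

(* Lebesgue measure on R^n; lebesgue_tuple n.+1 is the image of the product of
   the measures on R and R^n under (a, s) |-> a :: s. *)
Fixpoint lebesgue_tuple n : {sigma_finite_measure set (n.-tuple mR) -> \bar R} :=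
  match n with
  | 0 => dirac ([tuple] : 0.-tuple mR)
  | m.+1 => lebesgue_tuple_step (lebesgue_tuple m)
  end.

End lebesgue_tuple.
Arguments lebesgue_tuple : clear implicits.

Section probability_notions.
Context {R : realType}.
Local Notation mR := (measurableTypeR R).

Definition has_density n (mu : set (n.-tuple mR) -> \bar R)
    (f : n.-tuple mR -> R) :=
  forall A, measurable A ->
    mu A = (\int[lebesgue_tuple R n]_(x in A) (f x)%:E)%E.

Definition mutually_independent {d} {T : measurableType d}
    (P : probability T R) (I : finType) (F : I -> set_system T) :=
  forall (J : {set I}) (E : I -> set T), (forall i, i \in J -> F i (E i)) ->
    P (\bigcap_(i in [set` J]) E i) = (\prod_(i in J) P (E i))%E.

(* Euler's integral; it is only meaningful for 0 < x. *)
Definition Gamma (x : R) : R :=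
  \int[lebesgue_measure]_(u in `]0, +oo[) (u `^ (x - 1) * expR (- u)).

Definition enorm n (x : n.-tuple mR) : R :=
  Num.sqrt (\sum_(i < n) (tnth x i : R) ^+ 2).

End probability_notions.

(* All indices start at 0: the tuple of free durations is (tau_1, ..., tau_n),
   a tuple of angles is (theta_1, ..., theta_{d-2}, phi), and the coordinates
   of the position are numbered 0, 1, ... *)
Section random_flight.
Context {R : realType}.
Local Notation mR := (measurableTypeR R).

(* The last duration is what remains of the time t. *)
Definition durations n (t : R) (s : n.-tuple mR) : n.+1.-tuple R :=
  [tuple of rcons s (t - \sum_(x <- s) x)].

Definition duration_density d n (nu t : R) (s : n.-tuple mR) : R :=
  let a := 2 * nu + d%:R - 1 in
  if all (fun x : R => 0 < x) s && (\sum_(x <- s) x < t) then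
    Gamma (n.+1%:R * a) / Gamma a ^+ n.+1 *
    ((\prod_(k < n.+1) tnth (durations t s) k `^ (2 * nu + d%:R - 2)) /
     t `^ (n.+1%:R * a - 1))
  else 0.

(* The exponent of sin theta_j is 2 nu + d - 1 - j for 1 <= j <= d - 2; the
   index below is j - 1. *)
Definition angle_density d (nu : R) (th : d.-1.-tuple mR) : R :=
  let phi := nth 0 th d.-2 in
  if [forall j : 'I_d.-2, 0 <= nth 0 th j <= pi] && (0 <= phi <= 2 * pi) then
    Gamma (nu + d%:R / 2) /
      (2 * pi `^ ((d%:R - 1) / 2) * Gamma (nu + 1 / 2)) *
    (\prod_(j < d.-2) sin (nth 0 th j) `^ (2 * nu + d%:R - 2 - j%:R)) *
    `|sin phi| `^ (2 * nu)
  else 0.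

Definition flight_coord d n (c t : R) (s : n.-tuple mR)
    (th : 'I_n.+1 -> d.-1.-tuple mR) (i : nat) : R :=
  c * \sum_(k < n.+1) tnth (durations t s) k *
        (\prod_(j < i) sin (nth 0 (th k) j)) * cos (nth 0 (th k) i).

Definition projection_density d m n (nu c t : R) (x : m.-tuple mR) : R :=
  let b := n.+1%:R / 2 * (2 * nu + d%:R - 1) in
  if enorm x < c * t then
    Gamma (b + 1 / 2) / Gamma (b - m%:R / 2 + 1 / 2) *
    ((c ^+ 2 * t ^+ 2 - enorm x ^+ 2) `^ (b - (m%:R + 1) / 2) /
     (pi `^ (m%:R / 2) * (c * t) `^ (n.+1%:R * (2 * nu + d%:R - 1) - 1)))
  else 0.

Section process.
Context {disp} {T : measurableType disp} {P : probability T R} {d n : nat}.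
Variables (m : nat) (c t : R).
Variables (tau : {RV P >-> n.-tuple mR})
          (theta : 'I_n.+1 -> {RV P >-> d.-1.-tuple mR}).

(* The sigma-algebra of the durations, then those of the angles of each
   segment. *)
Definition flight_algebras (o : option 'I_n.+1) : set_system T :=
  if o is Some k then g_sigma_algebra_preimage (theta k)
  else g_sigma_algebra_preimage tau.

Definition flight_projection (w : T) : m.-tuple mR :=
  [tuple flight_coord c t (tau w) (fun k => theta k w) i | i < m].

Let measurable_nth (V : measurableType disp) p (X : V -> p.-tuple mR) (i : nat) :
  measurable_fun setT X -> measurable_fun setT (fun w => nth 0 (X w) i : R).
Proof.
move=> mX; have [ip|pi] := ltnP i p.
  rewrite (_ : (fun w => _) = (fun x => tnth x (Ordinal ip)) \o X).
    apply: measurableT_comp => //; exact: measurable_tnth.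
  by apply/funext => w /=; rewrite (tnth_nth 0).
rewrite (_ : (fun w => _) = cst 0); first exact: measurable_cst.
by apply/funext => w /=; rewrite nth_default// size_tuple.
Qed.

Lemma measurable_flight_projection : measurable_fun setT flight_projection.
Proof.
apply/measurable_fun_tnthP => i.
rewrite (_ : _ \o _ = fun w => flight_coord c t (tau w) (fun k => theta k w) i); last first.
  by apply/funext => w /=; rewrite tnth_mktuple.
suff : measurable_fun setT
  (fun w => flight_coord c t (tau w) (fun k => theta k w) i : R) by [].
apply: measurable_funM => //; apply: measurable_sum => k.
apply: measurable_funM; first apply: measurable_funM.
- case: (ltnP k n) => kn.
    rewrite (_ : (fun w => _) = fun w => nth 0 (tau w) k); first exact: measurable_nth.
    by apply/funext => w; rewrite (tnth_nth 0) /= nth_rcons size_tuple kn.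
  rewrite (_ : (fun w => _) = fun w => t - \sum_(i < n) nth 0 (tau w) i).
    apply: measurable_funB => //; apply: measurable_sum => j.
    exact: measurable_nth.
  apply/funext => w; rewrite (tnth_nth 0) /= nth_rcons size_tuple ltnNge kn /=.
  rewrite eqn_leq kn -ltnS ltn_ord /= big_tuple; congr (_ - _).
  by apply: eq_bigr => j _; rewrite (tnth_nth 0).
- apply: measurable_prod => j _; apply: (measurableT_comp (f := @sin R)).
    exact: (continuous_measurable_fun (@continuous_sin R)).
  exact: measurable_nth.
- apply: (measurableT_comp (f := @cos R)).
    exact: (continuous_measurable_fun (@continuous_cos R)).
  exact: measurable_nth.
Qed.

HB.instance Definition _ := isMeasurableFun.Build _ _ _ _
  flight_projection measurable_flight_projection.

End process.
End random_flight.

(* Main.v *)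
Require Import Defs.
From HB Require Import structures.
From mathcomp Require Import all_boot all_order all_algebra.
From mathcomp Require Import all_classical all_reals all_analysis.
From mathcomp Require Import measurable_realfun ring lra.

Set Implicit Arguments.
Unset Strict Implicit.
Unset Printing Implicit Defensive.

Import Order.TTheory GRing.Theory Num.Theory.
Import numFieldNormedType.Exports.

Local Open Scope classical_set_scope.
Local Open Scope ring_scope.

(** The first [m] coordinates of one random direction have a density on the
    unit ball of R^m proportional to [(1 - |x|^2)^p], where
    [p = nu + (d - 2 - m) / 2]: this follows by induction on the number of
    angles from the substitution [x = cos theta] ([angle_projection]).  Up to a
    constant, the density of the durations is the product of the powers
    [tau_k^(2 p + m)], and this is exactly the power for which
    [tau^(2 p + m)] times the law of [tau V], [V] being a projected direction,
    has density proportional to [(tau^2 - |y|^2)^p] on the cone [|y| < tau]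
    ([integral_one_step]).  Integrating over the durations with a fixed sum
    and over the independent directions therefore computes, at time [t], the
    [n + 1]-fold convolution on R x R^m of this kernel with itself.

    Powers of the Lorentz form on the cone are closed under convolution
    ([riesz_convolution]): exponents [p] and [q] give the exponent
    [p + q + (m + 1) / 2].  In the light-cone coordinates [u = s + y_1],
    [v = s - y_1] the form is [u v - |y'|^2]; the integral over [v] is a beta
    integral, completing the square turns the one over [y'] into the volume of
    a ball with a power weight, and the integral over [u] is again a beta
    integral.  By induction the law of the sum at time [t] is a multiple of
    [(t^2 - |y|^2)^q] with [q = (n + 1) (2 nu + d - 1) / 2 - (m + 1) / 2]
    ([integral_duration_weight]), and a dilation by [c] gives the shape of the
    projection density.

    All multiplicative constants on the way are elements of [[0, +oo]] whose
    value is irrelevant, since the total mass one determines the last one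
    ([ball_density_constant]).  It is evaluated by integrating
    [(w - |y|^2)^q exp(-w)] over [w] and [y] in the two orders
    ([gamma_ball]).  In particular the normalising constants of the duration
    and angle densities play no role.

    Independence enters through [ge0_expectation_iid]: the joint law of the
    durations and the projected directions is a product law. *)

(** * Measures with a density and iterated integrals *)
Section density_measure.
Context d (T : measurableType d) (R : realType).
Variables (mu : {measure set T -> \bar R}) (f : T -> R).
Hypotheses (mf : measurable_fun setT f) (f0 : forall x, 0 <= f x).
Local Open Scope ereal_scope.

Import HBNNSimple.

Lemma semi_sigma_additive_density :
  semi_sigma_additive (fun A => \int[mu]_(x in A) (f x)%:E).
Proof.
move=> /= F mF tF mUF; apply: cvg_toP.
  apply: ereal_nondecreasing_is_cvgn => m n mn.
  by apply: lee_sum_nneg_natr => // k _ _; apply: integral_ge0 => x _;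
    rewrite lee_fin.
rewrite ge0_integral_bigcup//=.
- by apply: measurable_funTS; exact/measurable_EFinP.
- by move=> x _; rewrite lee_fin.
Qed.

(** If [nu] has density [f] with respect to [mu], then integrating against
    [nu] is integrating the product with [f] against [mu]. *)
Lemma ge0_integral_density (nu : {measure set T -> \bar R}) (g : T -> \bar R) :
  (forall A, measurable A -> nu A = \int[mu]_(x in A) (f x)%:E) ->
  measurable_fun setT g -> (forall x, 0 <= g x) ->
  \int[nu]_x g x = \int[mu]_x (g x * (f x)%:E).
Proof.
move=> nuE mg g0; pose g_ := nnsfun_approx measurableT mg.
have g_cvg x : (g_ n x)%:E @[n --> \oo] --> g x.
  by apply: cvg_nnsfun_approx => // *; exact: g0.
have ndg x : nondecreasing_seq (fun n => (g_ n x)%:E).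
  by move=> m n mn; rewrite lee_fin; exact/lefP/nd_nnsfun_approx.
transitivity (limn (fun n => \int[nu]_x (g_ n x)%:E)).
  rewrite -monotone_convergence//.
  - by apply: eq_integral => x _; apply/esym/cvg_lim.
  - by move=> n; exact/measurable_EFinP.
  - by move=> n x _; rewrite lee_fin.
transitivity (limn (fun n => \int[mu]_x ((g_ n x)%:E * (f x)%:E))); last first.
  rewrite -monotone_convergence//.
  - by apply: eq_integral => x _; apply/cvg_lim => //; exact: cvgeZr.
  - by move=> n; apply: emeasurable_funM; exact/measurable_EFinP.
  - by move=> n x _; rewrite mule_ge0// lee_fin.
  - by move=> x _ m n mn; rewrite lee_wpmul2r ?lee_fin//; exact/lefP/nd_nnsfun_approx.
congr (limn _); apply/funext => n.
have mi r : measurable_fun setT (fun x => (r * \1_(g_ n @^-1` [set r]) x)%:E).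
  by apply/measurable_EFinP; exact: measurable_funM.
transitivity (\sum_(r \in range (g_ n))
    \int[mu]_x ((r * \1_(g_ n @^-1` [set r]) x)%:E * (f x)%:E)).
  under eq_integral do rewrite fimfunE -fsumEFin//.
  rewrite ge0_integral_fsum//; last by move=> r x _; exact: nnfun_muleindic_ge0.
  apply: eq_fsbigr => r _; rewrite integralZl_indic_nnsfun// integral_indic// setIT.
  rewrite nuE//; under [RHS]eq_integral do rewrite EFinM -muleA.
  have [r0|r0] := leP 0%R r.
    rewrite ge0_integralZl_EFin//.
    - rewrite [in LHS]integral_mkcond/=; congr (_ * _); apply: eq_integral => x _.
      by rewrite patchE indicE; case: ifPn => _; rewrite ?mul1e ?mul0e.
    - by move=> x _; rewrite mule_ge0 ?lee_fin.
    - by apply: emeasurable_funM => //; exact/measurable_EFinP.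
  rewrite preimage_nnfun0// integral_set0 mule0; apply/esym/integral0_eq => x _.
  by rewrite indic0 mul0e mule0.
rewrite -ge0_integral_fsum//.
- by apply: eq_integral => x _; rewrite -ge0_mule_fsuml ?fsumEFin// -?fimfunE// =>
    r; exact: nnfun_muleindic_ge0.
- by move=> r; apply: emeasurable_funM => //; exact/measurable_EFinP.
- by move=> r x _; rewrite mule_ge0 ?lee_fin// -lee_fin EFinM nnfun_muleindic_ge0.
Qed.

End density_measure.

Section fdensity.
Context d (T : measurableType d) (R : realType).
Variables (mu : {measure set T -> \bar R}) (f : T -> R).

(** The measure with density [f] with respect to [mu]. *)
Definition fdensity (A : set T) : \bar R := (\int[mu]_(x in A) (f x)%:E)%E.

Hypotheses (mf : measurable_fun setT f) (f0 : forall x, 0 <= f x).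

Let fdensity0 : fdensity set0 = 0%E.
Proof. exact: integral_set0. Qed.

Let fdensity_ge0 A : (0 <= fdensity A)%E.
Proof. by apply: integral_ge0 => x _; rewrite lee_fin. Qed.

HB.instance Definition _ := isMeasure.Build _ _ _ fdensity
  fdensity0 fdensity_ge0 (@semi_sigma_additive_density _ _ _ mu f mf f0).

End fdensity.

Section integral_mkcond_bool.
Context d (T : measurableType d) (R : realType) (mu : {measure set T -> \bar R}).
Local Open Scope ereal_scope.

Lemma integral_mkcond_bool (D : set T) (b : T -> bool) (f : T -> \bar R) :
  (forall x, D x <-> b x) ->
  \int[mu]_(x in D) f x = \int[mu]_x (if b x then f x else 0).
Proof.
move=> Db; rewrite integral_mkcond; apply: eq_integral => x _; rewrite patchE.
by rewrite (_ : (x \in D) = b x)//; apply/idP/idP; rewrite inE Db.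
Qed.

End integral_mkcond_bool.

(** Tonelli's theorem for functions of two arguments. *)
Section curried_tonelli.
Context d1 d2 (T1 : measurableType d1) (T2 : measurableType d2) (R : realType).
Variables (m1 : {sigma_finite_measure set T1 -> \bar R})
          (m2 : {sigma_finite_measure set T2 -> \bar R}).
Variable f : T1 -> T2 -> \bar R.
Local Open Scope ereal_scope.
Hypothesis mf : measurable_fun setT (fun z : T1 * T2 => f z.1 z.2).
Hypothesis f0 : forall x y, 0 <= f x y.

Lemma measurable_fun_ge0_integral : measurable_fun setT (fun x => \int[m2]_y f x y).
Proof.
exact: (measurable_fun_fubini_tonelli_F _ mf (fun z : T1 * T2 => f0 z.1 z.2)).
Qed.

Lemma ge0_integral_swap :
  \int[m1]_x \int[m2]_y f x y = \int[m2]_y \int[m1]_x f x y.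
Proof. exact: (@fubini_tonelli _ _ _ _ _ m1 m2 _ mf
  (fun z : T1 * T2 => f0 z.1 z.2)). Qed.

Lemma ge0_integral_prod :
  \int[m1 \x m2]_z f z.1 z.2 = \int[m1]_x \int[m2]_y f x y.
Proof. exact: (@fubini_tonelli1 _ _ _ _ _ m1 m2 _ mf
  (fun z : T1 * T2 => f0 z.1 z.2)). Qed.

End curried_tonelli.

Lemma measurable_fun0tuple d (T : measurableType d) d' (U : measurableType d')
  (f : 0.-tuple T -> U) : measurable_fun setT f.
Proof.
rewrite (_ : f = cst (f [tuple])); first exact: measurable_cst.
by apply/funext => x; rewrite (tuple0 x).
Qed.

(** * Affine changes of variables *)
Section affine.
Context {R : realType}.
Local Open Scope ereal_scope.
Local Notation mR := (measurableTypeR R).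
Local Notation mu := (@lebesgue_measure R).

Lemma measurable_affine (k a : R) : measurable_fun [set: mR]
  (fun x : mR => k * x + a : mR)%R.
Proof.
by apply: measurable_funD => //; exact: mulrl_measurable.
Qed.

(** Both measures are compared on the half-open intervals: the affine map
    pulls them back to half-open intervals, whose orientation depends on the
    sign of [k]. *)
Lemma lebesgue_measure_affine (k a : R) (A : set mR) : k != 0%R -> measurable A ->
  `|k|%:E * pushforward mu (fun x : mR => k * x + a : mR)%R A = mu A.
Proof.
move=> k0 mA.
set phi := (fun x : mR => k * x + a : mR)%R.
have mphi : measurable_fun setT phi by exact: measurable_affine.
pose nu : {measure set mR -> \bar R} :=
  mscale (NngNum (normr_ge0 k)) (pushforward mu phi).
transitivity (nu mphi A); first by [].
apply/esym/lebesgue_measure_unique => // _ [[x y]] _ <-.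
rewrite /nu /= /mscale/= /pushforward.
have [kp|kn|kz] := ltgtP k 0%R; last by rewrite kz eqxx in k0.
- have -> : (phi @^-1` `]x, y])%classic = `[((y - a) / k)%R, ((x - a) / k)%R[%classic.
    apply/seteqP; split => z /=; rewrite /phi !in_itv/= ler_ndivrMr//
      ltr_ndivlMr// => /andP[? ?]; apply/andP; split; lra.
  rewrite !lebesgue_measure_itv/= !lte_fin ltr_nM2r ?invr_lt0// ltrD2r.
  case: ifPn => _; last by rewrite mule0.
  rewrite -!EFinD -EFinM ltr0_norm//; congr EFin; field.
  by rewrite lt_eqF.
- have -> : (phi @^-1` `]x, y])%classic = `]((x - a) / k)%R, ((y - a) / k)%R]%classic.
    apply/seteqP; split => z /=; rewrite /phi !in_itv/= ler_pdivlMr//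
      ltr_pdivrMr// => /andP[? ?]; apply/andP; split; lra.
  rewrite !lebesgue_measure_itv/= !lte_fin ltr_pM2r ?invr_gt0// ltrD2r.
  case: ifPn => _; last by rewrite mule0.
  rewrite -!EFinD -EFinM gtr0_norm//; congr EFin; field.
  by rewrite gt_eqF.
Qed.

Lemma ge0_integral_affine (k a : R) (f : mR -> \bar R) : k != 0%R ->
  measurable_fun setT f -> (forall x, 0 <= f x) ->
  \int[mu]_x f (k * x + a)%R = (`|k|^-1)%:E * \int[mu]_x f x.
Proof.
move=> k0 mf f0.
set phi := (fun x : mR => k * x + a : mR)%R.
have mphi : measurable_fun setT phi by exact: measurable_affine.
pose nu : {measure set mR -> \bar R} :=
  pushforward mu phi.
have -> : \int[mu]_x f x = \int[mscale (NngNum (normr_ge0 k)) (nu mphi)]_x f x.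
  by apply: eq_measure_integral => A mA _; exact/esym/(lebesgue_measure_affine a k0).
rewrite ge0_integral_mscale// muleA -EFinM mulVf ?normr_eq0// mul1e.
by rewrite ge0_integral_pushforward.
Qed.

Lemma ge0_integral_shift (a : R) (f : mR -> \bar R) :
  measurable_fun setT f -> (forall x, 0 <= f x) ->
  \int[mu]_x f (x + a)%R = \int[mu]_x f x.
Proof.
move=> mf f0; rewrite -[RHS]mul1e.
have := @ge0_integral_affine 1 a f (oner_neq0 _) mf f0.
by rewrite normr1 invr1 => <-; under [RHS]eq_integral do rewrite mul1r.
Qed.

End affine.

Section tuples.
Context {R : realType}.
Local Open Scope ereal_scope.
Local Notation mR := (measurableTypeR R).
Local Notation mu := (@lebesgue_measure R).
Local Notation leb := (lebesgue_tuple R).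

Lemma integral_lebesgue_tuple0 (f : 0.-tuple mR -> \bar R) :
  \int[leb 0]_x f x = f [tuple].
Proof.
by rewrite integral_dirac ?diracT ?mul1e//; exact: measurable_fun0tuple.
Qed.

Lemma integral_lebesgue_tupleS n (f : n.+1.-tuple mR -> \bar R) :
  measurable_fun setT f -> (forall x, 0 <= f x) ->
  \int[leb n.+1]_x f x = \int[mu]_a \int[leb n]_s f (cons_pair (a, s)).
Proof.
move=> mf f0.
rewrite [LHS](ge0_integral_pushforward (@measurable_cons_pair R n) (mu \x leb n))//.
rewrite preimage_setT.
rewrite fubini_tonelli1//; last by move=> x; exact: f0.
apply: measurableT_comp => //; exact: measurable_cons_pair.
Qed.

(** The vector [k x + a]. *)
Definition scale_shift n (k : R) (a x : n.-tuple mR) : n.-tuple mR :=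
  [tuple (k * tnth x i + tnth a i)%R | i < n].

Lemma measurable_scale_shift n k (a : n.-tuple mR) :
  measurable_fun setT (scale_shift k a).
Proof.
apply/measurable_fun_tnthP => i.
rewrite (_ : _ \o _ = fun x => k * tnth x i + tnth a i)%R; last first.
  by apply/funext => x /=; rewrite tnth_mktuple.
apply: (measurableT_comp (@measurable_affine R k (tnth a i))).
exact: measurable_tnth.
Qed.

Lemma scale_shift_cons n k (a : n.+1.-tuple mR) x s :
  scale_shift k a (cons_pair (x, s)) =
  cons_pair (k * x + thead a, scale_shift k [tuple of behead a] s)%R.
Proof.
apply: eq_from_tnth => i; rewrite tnth_mktuple.
case: (unliftP ord0 i) => [j ->|->]; last by rewrite !tnth0.
rewrite !tnthS tnth_mktuple; congr (_ + _)%R.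
by rewrite [in LHS](tuple_eta a) tnthS.
Qed.

Lemma ge0_integral_scale_shift n (k : R) (a : n.-tuple mR)
  (f : n.-tuple mR -> \bar R) :
  (0 < k)%R -> measurable_fun setT f -> (forall x, 0 <= f x) ->
  \int[leb n]_x f (scale_shift k a x) = (k ^- n)%:E * \int[leb n]_x f x.
Proof.
move=> k0; elim: n a f => [|n IH] a f mf f0.
  rewrite !integral_lebesgue_tuple0 expr0 invr1 mul1e.
  by congr f; exact: tuple0.
rewrite !integral_lebesgue_tupleS//;
  last exact: measurableT_comp (measurable_scale_shift _ _).
have mfc : measurable_fun setT (f \o @cons_pair R n).
  by apply: measurableT_comp => //; exact: measurable_cons_pair.
pose g x := \int[leb n]_s f (cons_pair (x, s)).
have mg : measurable_fun setT g.
  by apply: (measurable_fun_ge0_integral (leb n)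
    (f := fun x s => f (cons_pair (x, s)))).
have g0 x : 0 <= g x by exact: integral_ge0.
transitivity (\int[mu]_x ((k ^- n)%:E * g (k * x + thead a)%R)).
  apply: eq_integral => x _; under eq_integral do rewrite scale_shift_cons.
  rewrite (IH _ (fun s => f (cons_pair (k * x + thead a, s)%R)))//.
  by apply: (measurableT_comp mfc); exact: measurable_pair1.
rewrite ge0_integralZl//; last 2 first.
- by apply: (measurableT_comp mg); exact: measurable_affine.
- by rewrite lee_fin invr_ge0 exprn_ge0// ltW.
rewrite ge0_integral_affine ?gt_eqF// muleA -EFinM gtr0_norm//.
by rewrite exprS invfM mulrC.
Qed.

Lemma ge0_integral_shift_tuple n (a : n.-tuple mR) (f : n.-tuple mR -> \bar R) :
  measurable_fun setT f -> (forall x, 0 <= f x) ->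
  \int[leb n]_x f (scale_shift 1 a x) = \int[leb n]_x f x.
Proof.
by move=> mf f0; rewrite ge0_integral_scale_shift// expr1n invr1 mul1e.
Qed.

End tuples.

(** * Truncated powers and the squared norm *)
Section truncated_power.
Context {R : realType}.
Implicit Types p q x k : R.

(** The truncated power [x_+^p]: it vanishes for [x <= 0], whatever [p] is. *)
Definition ppow p x : R := if 0 < x then x `^ p else 0.

Lemma ppow_ge0 p x : 0 <= ppow p x.
Proof. by rewrite /ppow; case: ifP => // _; exact: powR_ge0. Qed.

Lemma ppow_gt0 p x : 0 < x -> ppow p x = x `^ p.
Proof. by rewrite /ppow => ->. Qed.

Lemma ppow_le0 p x : x <= 0 -> ppow p x = 0.
Proof. by rewrite /ppow ltNge => ->. Qed.

Lemma ppowM p k x : 0 < k -> ppow p (k * x) = k `^ p * ppow p x.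
Proof.
move=> k0; rewrite /ppow pmulr_rgt0//; case: ifPn => [x0|_]; last by rewrite mulr0.
by rewrite powRM// ltW.
Qed.

Lemma mul_ppow p q x : ppow p x * ppow q x = ppow (p + q) x.
Proof.
rewrite /ppow; case: ifPn => [x0|_]; last by rewrite mulr0.
by rewrite powRD//; apply/implyP => _; rewrite gt_eqF.
Qed.

Lemma measurable_ppow p : measurable_fun [set: measurableTypeR R] (ppow p).
Proof.
apply: (@measurable_fun_ifT _ _ _ R (fun x => x `^ p) (cst 0) (fun x => 0 < x)).
- by apply: (@measurable_fun_ltr _ _ R setT (cst 0) id).
- exact: measurable_powR.
- exact: measurable_cst.
Qed.

Lemma measurable_ppow_comp d (T : measurableType d) p (f : T -> R) :
  measurable_fun setT f -> measurable_fun setT (fun w => ppow p (f w)).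
Proof. by move=> mf; exact: (measurableT_comp (measurable_ppow p)). Qed.

End truncated_power.

Section squared_norm.
Context {R : realType}.
Local Notation mR := (measurableTypeR R).

(** The squared Euclidean norm. *)
Definition sqnorm n (x : n.-tuple mR) : R := \sum_(i < n) (tnth x i : R) ^+ 2.

Lemma sqnorm_ge0 n (x : n.-tuple mR) : 0 <= sqnorm x.
Proof. by apply: sumr_ge0 => i _; exact: sqr_ge0. Qed.

Lemma sqnorm_cons n a (s : n.-tuple mR) :
  sqnorm (cons_pair (a, s)) = a ^+ 2 + sqnorm s.
Proof.
by rewrite /sqnorm big_ord_recl tnth0; congr (_ + _); apply: eq_bigr => i _;
  rewrite tnthS.
Qed.

Lemma measurable_sqnorm n : measurable_fun setT (@sqnorm n).
Proof.
apply: measurable_sum => i.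
apply: (@measurable_funX _ _ R setT (fun x : n.-tuple mR => tnth x i)).
exact: measurable_tnth.
Qed.

(** The zero vector; [scale_shift k (zero_tuple n)] is the dilation by [k]. *)
Definition zero_tuple n : n.-tuple mR := [tuple 0 | i < n].

Lemma sqnorm_scale n k (x : n.-tuple mR) :
  sqnorm (scale_shift k (zero_tuple n) x) = k ^+ 2 * sqnorm x.
Proof.
by rewrite /sqnorm mulr_sumr; apply: eq_bigr => i _;
  rewrite !tnth_mktuple addr0 exprMn.
Qed.

End squared_norm.

(** * Beta integrals and integrals over balls *)
Section integrals.
Context {R : realType}.
Local Notation mR := (measurableTypeR R).
Local Notation mu := (@lebesgue_measure R).
Local Notation leb := (lebesgue_tuple R).
Local Open Scope ereal_scope.

(** Euler's beta integral with the exponents [p] and [q] themselves, so that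
    it is [B(p + 1, q + 1)]; it may be infinite. *)
Definition beta_integral (p q : R) : \bar R :=
  \int[mu]_w (ppow p w * ppow q (1 - w))%:E.

(** The integral of [(1 - |y|^2)^p] over the unit ball of R^n; it may be
    infinite. *)
Definition ball_integral n (p : R) : \bar R :=
  \int[leb n]_y (ppow p (1 - sqnorm y))%:E.

Lemma beta_integral_ge0 p q : 0 <= beta_integral p q.
Proof. by apply: integral_ge0 => w _; rewrite lee_fin mulr_ge0// ppow_ge0. Qed.

Lemma ball_integral_ge0 n p : 0 <= ball_integral n p.
Proof. by apply: integral_ge0 => w _; rewrite lee_fin ppow_ge0. Qed.

(** The affine map from [[0, 1]] to [[a, b]] reduces this to
    [beta_integral]; both sides vanish if [b <= a]. *)
Lemma integral_beta_segment (p q a b : R) :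
  \int[mu]_v (ppow p (v - a) * ppow q (b - v))%:E
  = beta_integral p q * (ppow (p + q + 1) (b - a))%:E.
Proof.
have [ba|ab] := leP b a.
  rewrite (ppow_le0 _ (_ : b - a <= 0)%R) ?subr_le0// mule0.
  apply: integral0_eq => v _; have [va|va] := leP v a.
    by rewrite ppow_le0 ?subr_le0// mul0r.
  by rewrite mulrC ppow_le0 ?mul0r// subr_le0 (le_trans ba)// ltW.
have h0 : (0 < b - a)%R by rewrite subr_gt0.
set h := (b - a)%R in h0 *.
have mf : measurable_fun setT (fun v : mR => (ppow p (v - a) * ppow q (b - v))%:E).
  apply/measurable_EFinP; apply: measurable_funM; apply: measurable_ppow_comp.
    exact: measurable_funB.
  exact: measurable_funB.
have hN : h != 0%R by rewrite gt_eqF.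
set f := (fun v => _) in mf *.
have -> : beta_integral p q = (h `^ (- (p + q)))%:E * \int[mu]_w f (h * w + a)%R.
  rewrite -ge0_integralZl//; last 3 first.
  - by apply: (measurableT_comp mf); exact: measurable_affine.
  - by move=> x _; rewrite lee_fin mulr_ge0// ppow_ge0.
  - by rewrite lee_fin powR_ge0.
  apply: eq_integral => w _; rewrite -EFinM; congr EFin.
  rewrite addrK (_ : b - _ = h * (1 - w))%R; last by rewrite /h; ring.
  have e : (h `^ (- (p + q)) * (h `^ p * h `^ q) = 1)%R.
    by rewrite -!powRD ?addNr ?powRr0 ?hN ?implybT.
  by rewrite !ppowM// [in RHS]mulrACA [in RHS](mulrA (h `^ (- (p + q)))%R) e mul1r.
rewrite ge0_integral_affine//; last by move=> x; rewrite lee_fin mulr_ge0// ppow_ge0.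
rewrite ppow_gt0// muleC muleA muleA -!EFinM gtr0_norm// -powR_inv1 ?ltW//.
rewrite -!powRD ?hN ?implybT//.
by rewrite (_ : _ + _ = 0)%R ?powRr0 ?mul1e//; ring.
Qed.

(** The dilation by [sqrt (W / k)] reduces this to [ball_integral]; both sides
    vanish if [W <= 0]. *)
Lemma integral_ball_scaled n (p W k : R) : (0 < k)%R ->
  \int[leb n]_y (ppow p (W - k * sqnorm y))%:E
  = ball_integral n p * (k `^ (- (n%:R / 2)) * ppow (p + n%:R / 2) W)%:E.
Proof.
move=> k0; have [W0|W0] := leP W 0%R.
  rewrite (ppow_le0 _ W0) mulr0 mule0; apply: integral0_eq => y _.
  by rewrite ppow_le0// subr_le0 (le_trans W0)// mulr_ge0 ?sqnorm_ge0// ltW.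
have mf : measurable_fun setT (fun y : n.-tuple mR => (ppow p (W - k * sqnorm y))%:E).
  apply/measurable_EFinP; apply: measurable_ppow_comp; apply: measurable_funB => //.
  by apply: measurable_funM => //; exact: measurable_sqnorm.
set f := (fun y => _) in mf *.
have h0 : (0 < Num.sqrt (W / k))%R by rewrite sqrtr_gt0 divr_gt0.
have -> : ball_integral n p = (W `^ (- p))%:E * \int[leb n]_w f
  (scale_shift (Num.sqrt (W / k)) (zero_tuple n) w).
  rewrite -ge0_integralZl//; last 3 first.
  - by apply: (measurableT_comp mf); exact: measurable_scale_shift.
  - by move=> x _; rewrite lee_fin ppow_ge0.
  - by rewrite lee_fin powR_ge0.
  apply: eq_integral => w _; rewrite -EFinM; congr EFin.
  rewrite sqnorm_scale sqr_sqrtr ?ltW ?divr_gt0//.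
  rewrite (_ : W - _ = W * (1 - sqnorm w))%R; last by field; rewrite gt_eqF.
  rewrite ppowM// mulrA -powRD; first by rewrite addNr powRr0 mul1r.
  by apply/implyP => _; rewrite gt_eqF.
rewrite ge0_integral_scale_shift//; last by move=> x; rewrite lee_fin ppow_ge0.
rewrite ppow_gt0// muleC muleA muleA -!EFinM.
suff -> : (k `^ (- (n%:R / 2)) * W `^ (p + n%:R / 2) * W `^ (- p)
   * Num.sqrt (W / k) ^- n)%R = 1%R by rewrite mul1e.
rewrite -powR12_sqrt ?divr_ge0 ?ltW// -powR_mulrn ?powR_ge0// -powRrM.
rewrite (mulrC 2^-1)%R; set e := (n%:R / 2)%R.
have Wn : (W `^ e)%R != 0%R by rewrite gt_eqF// powR_gt0.
have Wp : (W `^ p)%R != 0%R by rewrite gt_eqF// powR_gt0.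
have kn : (k `^ e)%R != 0%R by rewrite gt_eqF// powR_gt0.
have -> : ((W / k) `^ e = W `^ e / k `^ e)%R.
  rewrite powRM ?invr_ge0 ?ltW//; congr (_ * _)%R.
  by rewrite -powR_inv1 ?ltW// -powRrM mulN1r powRN.
rewrite powRD ?(gt_eqF W0) ?implybT// !powRN; field.
by rewrite Wp Wn kn.
Qed.

(** * Convolution on the Lorentz cone *)

(** The kernel of the cone [|y| < s]: the Lorentz form [s^2 - |y|^2] to the
    power [p], extended by zero. *)
Definition cone n p (s : R) (y : n.-tuple mR) : R :=
  if (0 < s)%R then ppow p (s ^+ 2 - sqnorm y)%R else 0%R.

Lemma cone_ge0 n p s (y : n.-tuple mR) : (0 <= cone p s y)%R.
Proof. by rewrite /cone; case: ifP => // _; exact: ppow_ge0. Qed.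

Lemma measurable_cone d (T : measurableType d) n p (s : T -> R)
  (y : T -> n.-tuple mR) :
  measurable_fun setT s -> measurable_fun setT y ->
  measurable_fun setT (fun w => cone p (s w) (y w)).
Proof.
move=> ms my.
apply: (@measurable_fun_ifT _ _ _ R (fun w => ppow p (s w ^+ 2 - sqnorm (y w))%R)
  (cst 0%R) (fun w => 0 < s w)%R).
- by apply: (@measurable_fun_ltr _ _ R setT (cst 0%R) s).
- apply: measurable_ppow_comp; apply: measurable_funB; first exact: measurable_funX.
  exact: (measurableT_comp (@measurable_sqnorm R n)).
- exact: measurable_cst.
Qed.

(** In the light-cone coordinates [u = s + a], [v = s - a] the Lorentz form
    [s^2 - a^2 - |y|^2] is [u v - |y|^2]. *)
Lemma cone_lightcone n p u v (y : n.-tuple mR) :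
  cone p ((v + u) / 2) (cons_pair (u - (v + u) / 2, y)%R)
  = (ppow p u * ppow p (v - sqnorm y / u))%R.
Proof.
rewrite /cone sqnorm_cons.
rewrite (_ : _ - _ = u * v - sqnorm y)%R; last by field.
have sy := sqnorm_ge0 y.
have [u0|u0] := ltP 0%R u.
  rewrite (_ : u * v - sqnorm y = u * (v - sqnorm y / u))%R; last first.
    by field; rewrite gt_eqF.
  rewrite ppowM// (ppow_gt0 p u0); have [//|uv] := ltP 0%R ((v + u) / 2)%R.
  rewrite (ppow_le0 _ (_ : _ <= 0)%R) ?mulr0// subr_le0.
  by rewrite (@le_trans _ _ 0%R) ?divr_ge0//; lra.
rewrite (ppow_le0 _ u0) mul0r; have [uv|//] := ltP 0%R ((v + u) / 2)%R.
rewrite ppow_le0// subr_le0 (le_trans _ sy)// mulr_le0_ge0//; lra.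
Qed.

(** The change of variables [u = s + a], [v = s - a]: first [u] replaces [a]
    at fixed [s], then [v = 2 s - u] replaces [s] at fixed [u], which gives
    the factor [1/2]. *)
Lemma ge0_integral_lightcone (H : mR * mR -> \bar R) :
  measurable_fun setT H -> (forall x, 0 <= H x) ->
  \int[mu]_s \int[mu]_a H (s, a)
  = (2^-1)%:E * \int[mu]_u \int[mu]_v H ((v + u) / 2, u - (v + u) / 2)%R.
Proof.
move=> mH H0.
transitivity (\int[mu]_s \int[mu]_u H (s, u - s)%R).
  apply: eq_integral => s _.
  rewrite (ge0_integral_shift (- s) (f := fun a => H (s, a)))//.
  exact: (measurableT_comp mH (measurable_pair1 s)).
rewrite (@ge0_integral_swap _ _ _ _ _ mu mu (fun s u => H (s, u - s)%R))//;
  last first.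
  apply: (measurableT_comp mH); apply: measurable_fun_pair => //.
  exact: measurable_funB.
have mK u : measurable_fun setT (fun s : mR => H (s, u - s)%R).
  apply: (measurableT_comp mH); apply: measurable_fun_pair => //.
  exact: measurable_funB.
rewrite -ge0_integralZl//; last 2 first.
- apply: (measurable_fun_ge0_integral mu
    (f := fun u v : mR => H ((v + u) / 2, u - (v + u) / 2)%R)) => //.
  apply: (measurableT_comp mH).
  have m2 : measurable_fun setT (fun z : mR * mR => (z.2 + z.1) / 2)%R.
    by apply: measurable_funM => //; exact: measurable_funD.
  by apply: measurable_fun_pair => //; exact: measurable_funB.
- by move=> u _; exact: integral_ge0.
apply: eq_integral => u _.
have hn : (2^-1 != 0 :> R)%R by rewrite invr_eq0.
have := @ge0_integral_affine R 2^-1%R (u / 2)%R _ hn (mK u) (fun _ => H0 _).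
rewrite gtr0_norm ?invr_gt0// invrK => e.
transitivity ((2^-1)%:E * (2%:E * \int[mu]_x H (x, (u - x)%R))).
  by rewrite muleA -EFinM mulVf// mul1e.
rewrite -e; congr (_ * _); apply: eq_integral => v _.
by rewrite (_ : 2^-1 * v + u / 2 = (v + u) / 2)%R//; field.
Qed.

(** Completing the square in [|y|^2 / u + |z - y|^2 / w] around
    [y = u / (u + w) z]. *)
Lemma sqnorm_complete_square n (u w : R) (z y : n.-tuple mR) :
  (0 < u)%R -> (0 < w)%R ->
  (sqnorm y / u + sqnorm (scale_shift (-1) z y) / w
   = sqnorm z / (u + w) + (u + w) / (u * w) * sqnorm
     (scale_shift 1 (scale_shift (- (u / (u + w))) (zero_tuple n) z) y))%R.
Proof.
move=> u0 w0; rewrite /sqnorm !mulr_suml mulr_sumr -!big_split/=.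
apply: eq_bigr => i _; rewrite !tnth_mktuple; field.
by rewrite !gt_eqF// addr_gt0.
Qed.

(** The constant of [riesz_convolution] on R x R^(n+1). *)
Definition riesz_constant n (p q : R) : \bar R :=
  2^-1%:E * (beta_integral p q * ball_integral n (p + q + 1) * beta_integral
    (p + n%:R / 2) (q + n%:R / 2)).

Lemma riesz_constant_ge0 n p q : 0 <= riesz_constant n p q.
Proof.
by rewrite /riesz_constant !mule_ge0 ?beta_integral_ge0 ?ball_integral_ge0// lee_fin
  invr_ge0.
Qed.

(** The integrals over [v] and over the [n] transverse coordinates, for
    fixed values [u] and [w] of the other light-cone coordinate at the two
    points: a beta integral in [v], then, after completing the square, a ball
    integral. *)
Lemma riesz_lightcone n p q (u w V : R) (z : n.-tuple mR) :
  \int[mu]_v \int[leb n]_y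
    (ppow p u * ppow p (v - sqnorm y / u)
      * (ppow q w * ppow q (V - v - sqnorm (scale_shift (-1) z y) / w)))%:E
  = beta_integral p q * ball_integral n (p + q + 1) *
    (ppow (p + n%:R / 2) u * ppow (q + n%:R / 2) w *
     ((u + w) `^ (- (n%:R / 2)) * ppow (p + q + 1 + n%:R / 2)
       (V - sqnorm z / (u + w))))%:E.
Proof.
have [u0|u0] := leP u 0%R.
  rewrite [in RHS](ppow_le0 _ u0) !mul0r mule0; apply: integral0_eq => v _.
  by apply: integral0_eq => y _; rewrite (ppow_le0 _ u0) !mul0r.
have [w0|w0] := leP w 0%R.
  rewrite [in RHS](ppow_le0 _ w0) mulr0 !mul0r mule0; apply: integral0_eq => v _.
  by apply: integral0_eq => y _; rewrite (ppow_le0 _ w0) mul0r mulr0.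
rewrite ge0_integral_swap; last 2 first.
- apply/measurable_EFinP.
  have m1 : measurable_fun setT (fun zz : mR * n.-tuple mR => sqnorm zz.2).
    exact: (measurableT_comp (@measurable_sqnorm R n)).
  have m2 : measurable_fun setT (fun zz :
    mR * n.-tuple mR => sqnorm (scale_shift (-1) z zz.2)).
    apply: (measurableT_comp (@measurable_sqnorm R n)).
    exact: (measurableT_comp (measurable_scale_shift _ _)).
  apply: measurable_funM; apply: measurable_funM => //; apply: measurable_ppow_comp.
    by apply: measurable_funB => //; exact: measurable_funM.
  apply: measurable_funB; last exact: measurable_funM.
  exact: measurable_funB.
- by move=> v y; rewrite lee_fin !mulr_ge0// ppow_ge0.
pose a := scale_shift (- (u / (u + w))) (zero_tuple n) z.
pose k := ((u + w) / (u * w))%R.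
have uw : (0 < u + w)%R by exact: addr_gt0.
have k0 : (0 < k)%R by rewrite divr_gt0// mulr_gt0.
pose f (y : n.-tuple mR) := (ppow (p + q + 1)
  (V - sqnorm z / (u + w) - k * sqnorm y))%:E.
have mf : measurable_fun setT f.
  apply/measurable_EFinP; apply: measurable_ppow_comp; apply: measurable_funB => //.
  by apply: measurable_funM => //; exact: measurable_sqnorm.
have f0 y : 0 <= f y by rewrite lee_fin ppow_ge0.
transitivity (\int[leb n]_y ((ppow p u * ppow q w)%:E * beta_integral p q * f
  (scale_shift 1 a y))).
  apply: eq_integral => y _.
  transitivity (\int[mu]_v ((ppow p u * ppow q w)%:E *
     (ppow p (v - sqnorm y / u) * ppow q
       (V - sqnorm (scale_shift (-1) z y) / w - v))%:E)).
    apply: eq_integral => v _; rewrite -EFinM; congr EFin.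
    by rewrite mulrACA; congr (_ * (_ * ppow _ _))%R; ring.
  rewrite ge0_integralZl//; last 3 first.
  - apply/measurable_EFinP; apply: measurable_funM; apply: measurable_ppow_comp.
      exact: measurable_funB.
    exact: measurable_funB.
  - by move=> v _; rewrite lee_fin mulr_ge0// ppow_ge0.
  - by rewrite lee_fin mulr_ge0// ppow_ge0.
  rewrite integral_beta_segment muleA; congr (_ * (ppow _ _)%:E).
  by rewrite -[RHS]addrA -opprD -sqnorm_complete_square//; ring.
rewrite ge0_integralZl//; last 2 first.
- by apply: (measurableT_comp mf); exact: measurable_scale_shift.
- by rewrite mule_ge0 ?beta_integral_ge0// lee_fin mulr_ge0// ppow_ge0.
rewrite ge0_integral_shift_tuple// /f integral_ball_scaled//.
rewrite -!mul_ppow -/k.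
have -> : (k `^ (- (n%:R / 2)) = (u + w) `^ (- (n%:R / 2))
  * (ppow (n%:R / 2) u * ppow (n%:R / 2) w))%R.
  rewrite !ppow_gt0// /k powRM ?invr_ge0 ?ltW// ?mulr_gt0//; congr (_ * _)%R.
  by rewrite -powR_inv1 ?ltW ?mulr_gt0// -powRrM mulN1r opprK powRM// ltW.
rewrite -!muleA muleCA; congr (_ * _).
rewrite muleCA; congr (_ * _).
by rewrite -!EFinM; congr EFin; ring.
Qed.

(** The convolution on R x R^(n+1) of the cone kernels of exponents [p] and
    [q] is a multiple of the cone kernel whose exponent is [p + q] plus half of
    the dimension [n + 2].  No condition is needed on [p] and [q], since the
    constant is allowed to be infinite. *)
Lemma riesz_convolution n p q (s : R) (z : n.+1.-tuple mR) :
  \int[mu]_x \int[leb n.+1]_y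
    (cone p x y * cone q (s - x) (scale_shift (-1) z y))%:E
  = riesz_constant n p q * (cone (p + q + (n.+1%:R + 1) / 2) s z)%:E.
Proof.
pose b := thead z; pose z' := [tuple of behead z].
have zE : z = cons_pair (b, z') by rewrite [LHS]tuple_eta.
pose H (w : mR * mR) := \int[leb n]_y
  (cone p w.1 (cons_pair (w.2, y)) * cone q (s - w.1)
    (scale_shift (-1) z (cons_pair (w.2, y))))%:E.
have mG : measurable_fun setT (fun w : mR * n.+1.-tuple mR =>
    (cone p w.1 w.2 * cone q (s - w.1) (scale_shift (-1) z w.2))%:E).
  apply/measurable_EFinP; apply: measurable_funM; apply: measurable_cone => //.
    exact: measurable_funB.
  exact: (measurableT_comp (measurable_scale_shift _ _)).
have mcp : measurable_fun setT (fun w :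
  (mR * mR) * n.-tuple mR => (w.1.1, cons_pair (w.1.2, w.2))).
  apply: measurable_fun_pair; first exact: (measurableT_comp measurable_fst).
  apply: (measurableT_comp (@measurable_cons_pair R n)).
  by apply: measurable_fun_pair => //; exact: (measurableT_comp measurable_snd).
have mH : measurable_fun setT H.
  apply: measurable_fun_ge0_integral; first exact: (measurableT_comp mG mcp).
  by move=> w y; rewrite lee_fin mulr_ge0// cone_ge0.
have H0 w : 0 <= H w by apply: integral_ge0 => y _;
  rewrite lee_fin mulr_ge0// cone_ge0.
transitivity (\int[mu]_x \int[mu]_a H (x, a)).
  apply: eq_integral => x _; rewrite integral_lebesgue_tupleS//.
    exact: (measurableT_comp mG (measurable_pair1 x)).
  by move=> y; rewrite lee_fin mulr_ge0// cone_ge0.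
rewrite ge0_integral_lightcone// /riesz_constant -muleA; congr (_ * _).
(* The light-cone coordinates of the point at which the convolution is
   evaluated. *)
set U := (s + b)%R; set V := (s - b)%R.
set r := (p + q + 1 + n%:R / 2)%R.
transitivity (\int[mu]_u (beta_integral p q * ball_integral n (p + q + 1) *
    (U `^ (- (n%:R / 2)) * ppow r (V - sqnorm z' / U))%:E *
    (ppow (p + n%:R / 2) u * ppow (q + n%:R / 2) (U - u))%:E)).
  apply: eq_integral => u _.
  transitivity (\int[mu]_v \int[leb n]_y
    (ppow p u * ppow p (v - sqnorm y / u)
      * (ppow q (U - u) * ppow q (V - v - sqnorm (scale_shift (-1) z' y) /
          (U - u))))%:E).
    apply: eq_integral => v _; apply: eq_integral => y _ /=.
    rewrite zE scale_shift_cons theadE cone_lightcone.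
    rewrite -(cone_lightcone q (U - u) (V - v)); congr EFin; congr (_ * _)%R.
    congr (cone _ _ (cons_pair (_, _))).
    - by rewrite /U /V; field.
    - by rewrite /U /V /=; field.
    - by congr (scale_shift _ _ _); exact: val_inj.
  rewrite riesz_lightcone (addrC u) subrK -!muleA; congr (_ * (_ * _)).
  by rewrite -EFinM; congr EFin; rewrite mulrC.
rewrite ge0_integralZl//; last 3 first.
- apply/measurable_EFinP; apply: measurable_funM; apply: measurable_ppow_comp => //.
  exact: measurable_funB.
- by move=> v _; rewrite lee_fin mulr_ge0// ppow_ge0.
- by rewrite !mule_ge0 ?beta_integral_ge0 ?ball_integral_ge0// lee_fin mulr_ge0
    ?powR_ge0// ppow_ge0.
under eq_integral do rewrite -[X in ppow (p + _) X]subr0.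
rewrite integral_beta_segment subr0 -!muleA; congr (_ * (_ * _)).
rewrite muleCA; congr (_ * _); rewrite -EFinM; congr EFin.
have -> : cone (p + q + (n.+1%:R + 1) / 2) s z
  = (ppow r U * ppow r (V - sqnorm z' / U))%R.
  rewrite -cone_lightcone {1}zE; congr (cone _ _ (cons_pair (_, _))).
  - by rewrite /r -natr1; field.
  - by rewrite /U /V; field.
  - by rewrite /U /V; field.
rewrite mulrAC; congr (_ * _)%R.
have [U0|U0] := ltP 0%R U; last by rewrite !ppow_le0 ?mulr0.
rewrite !ppow_gt0// -powRD ?(gt_eqF U0) ?implybT//; congr (_ `^ _)%R.
by rewrite /r; field.
Qed.

End integrals.

(** * The substitution by the cosine *)
Section cosine_substitution.
Context {R : realType}.
Local Notation mR := (measurableTypeR R).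
Local Notation mu := (@lebesgue_measure R).
Local Open Scope ereal_scope.

(* [S] is the Jacobian of [cos] on (0, pi), and [I] the indicator of its image. *)
Let S (x : mR) : R := if (0 < x < pi)%R then sin x else 0%R.
Let I (x : mR) : R := if (-1 < x < 1)%R then 1%R else 0%R.

Lemma measurable_between (a b : R) :
  measurable_fun setT (fun x : mR => (a < x < b)%R).
Proof.
apply: measurable_and.
  exact: (@measurable_fun_ltr _ _ R setT (cst a) id).
exact: (@measurable_fun_ltr _ _ R setT id (cst b)).
Qed.

Lemma measurable_sin : measurable_fun [set: mR] (@sin R : mR -> mR).
Proof. exact: (continuous_measurable_fun (@continuous_sin R)). Qed.

Lemma measurable_cos : measurable_fun [set: mR] (@cos R : mR -> mR).
Proof. exact: (continuous_measurable_fun (@continuous_cos R)). Qed.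

Let mS : measurable_fun setT S.
Proof.
apply: (@measurable_fun_ifT _ _ mR R (@sin R) (cst 0%R) (fun x => 0 < x < pi)%R).
- exact: measurable_between.
- exact: measurable_sin.
- exact: measurable_cst.
Qed.

Let S0 x : (0 <= S x)%R.
Proof. by rewrite /S; case: ifPn => // /sin_gt0_pi/ltW. Qed.

Let mI : measurable_fun setT I.
Proof.
apply: (@measurable_fun_ifT _ _ mR R (cst 1%R) (cst 0%R) (fun x => -1 < x < 1)%R).
- exact: measurable_between.
- exact: measurable_cst.
- exact: measurable_cst.
Qed.

Let I0 x : (0 <= I x)%R.
Proof. by rewrite /I; case: ifPn. Qed.

Lemma integral_sin_itv (a : R) : (0 <= a)%R ->
  \int[mu]_(x in `]0%R, a[) (sin x)%:E = (1 - cos a)%:E.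
Proof.
rewrite le_eqVlt => /predU1P[<-|a0].
  by rewrite set_itvoo0 integral_set0 cos0 subrr.
rewrite -(@integral_itv_bndoo R 0 a _ true false); last first.
  by apply/measurable_EFinP; apply: measurable_funTS; exact: measurable_sin.
rewrite (@continuous_FTC2 R (@sin R) (- @cos R)%R 0 a)//.
- by rewrite -EFinD !fctE cos0 opprK addrC.
- by apply: continuous_subspaceT; exact: continuous_sin.
- split.
  + by move=> x _; apply: derivableN; exact: derivable_cos.
  + by apply: cvg_at_right_filter; apply: cvgN; exact: continuous_cos.
  + by apply: cvg_at_left_filter; apply: cvgN; exact: continuous_cos.
- by move=> x _; rewrite derive1E deriveN// derive_val opprK.
Qed.

(* Truncating [x] to [-1, 1] does not change its comparison with the points of
   (-1, 1), and makes [acos] available. *)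
Let clip (x : R) : exists2 x' : R, (-1 <= x' <= 1)%R &
  (forall y, -1 < y < 1 -> (x < y) = (x' < y))%R.
Proof.
have [x1|x1] := leP x (-1)%R.
  by exists (-1)%R; [lra|move=> y /andP[y1 y2]; rewrite y1; apply/idP; lra].
have [x2|x2] := leP x 1%R; first by exists x => //; lra.
exists 1%R; first lra.
by move=> y /andP[y1 y2]; apply/idP/idP; lra.
Qed.

(* The image under [cos] of the measure with density [S], and the measure with
   density [I], agree on the ray (x, +oo). *)
Let ray_sin (x : R) :
  \int[mu]_(y in cos @^-1` `]x, +oo[) (S y)%:E = \int[mu]_(y in `]x, +oo[) (I y)%:E.
Proof.
have [x' x'1 xx'] := clip x.
have ax : (0 <= acos x')%R by rewrite acos_ge0.
have axp : (acos x' <= pi)%R by rewrite acos_lepi.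
transitivity (1 - x')%:E.
  rewrite -[in RHS](@acosK R x') ?in_itv//= -integral_sin_itv//.
  rewrite [LHS](integral_mkcond_bool _ (b := fun y : mR => x < cos y)%R); last first.
    by move=> y; rewrite /= in_itv/= andbT.
  rewrite [RHS](integral_mkcond_bool _ (b := fun y : mR => 0 < y < acos x')%R);
    last first.
    by move=> y; rewrite /= in_itv/=.
  apply: eq_integral => y _; rewrite /S.
  case: (boolP (0 < y < pi)%R) => yp; last first.
    rewrite if_same; case: ifPn => // yx; exfalso; move/negP: yp; apply; lra.
  have cy : (-1 < cos y < 1)%R.
    by rewrite -cospi -cos0 !ltr_cos ?in_itv/= ?lexx ?pi_ge0//; lra.
  rewrite xx'// -[X in (X < cos y)%R](@acosK R) ?in_itv//=.
  rewrite ltr_cos; first by case/andP: yp => -> _.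
    by case/andP: yp => y0 y1; rewrite in_itv/= !ltW.
  by rewrite in_itv/= ax.
transitivity (\int[mu]_(y in `]x', 1%R[) 1).
  rewrite integral_cst//= mul1e lebesgue_measure_itv/= lte_fin.
  by case: ltP => // x'1'; congr EFin; lra.
rewrite [LHS](integral_mkcond_bool _ (b := fun y : mR => x' < y < 1)%R); last first.
  by move=> y; rewrite /= in_itv/=.
rewrite [RHS](integral_mkcond_bool _ (b := fun y : mR => x < y)%R); last first.
  by move=> y; rewrite /= in_itv/= andbT.
apply: eq_integral => y _; rewrite /I.
have [yy|yy] := boolP (-1 < y < 1)%R.
  by rewrite xx'//; case/andP: yy => _ ->; rewrite andbT.
rewrite if_same; case: ifPn => // yx; exfalso; move/negP: yy; apply; lra.
Qed.

(** The substitution [x = cos theta] on (0, pi): rays generate the Borel sets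
    and are stable under intersection. *)
Lemma ge0_integral_cos_sin (h : mR -> \bar R) :
  measurable_fun setT h -> (forall x, 0 <= h x) ->
  \int[mu]_x (h (cos x) * (S x)%:E) = \int[mu]_x (h x * (I x)%:E).
Proof.
move=> mh h0.
have mc : measurable_fun setT (@cos R : mR -> mR) := measurable_cos.
pose m1 : {measure set mR -> \bar R} := fdensity mu S.
pose m2 : {measure set mR -> \bar R} := fdensity mu I.
pose m3 : {measure set mR -> \bar R} := pushforward (m1 mS S0) (@cos R : mR -> mR).
transitivity (\int[m1 mS S0]_x (h (cos x))).
  rewrite [RHS](@ge0_integral_density _ _ R mu S mS S0)//.
  exact: measurableT_comp.
transitivity (\int[m3 mc]_x h x).
  by rewrite ge0_integral_pushforward.
transitivity (\int[m2 mI I0]_x h x); last first.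
  by rewrite [LHS](@ge0_integral_density _ _ R mu I mI I0).
apply: eq_measure_integral => A mA _.
apply: (@measure_unique _ R mR (@RGenOInfty.G R)
  (fun k => `](- k%:R)%R, +oo[%classic) _ _ _ _ (m3 mc) (m2 mI I0)) => //.
- exact: RGenOInfty.measurableE.
- move=> _ _ [x ->] [y ->]; exists (Num.max x y).
  rewrite predeqE => z; rewrite /= !in_itv/= !andbT gt_max;
    split=> [[-> ->]//|/andP[]//].
- by move=> i; exists (- i%:R)%R.
- rewrite -subTset => x _; exists (Num.truncn `|x|).+1 => //=.
  rewrite in_itv/= andbT ltrNl (le_lt_trans _ (truncnS_gt _))//.
  by rewrite -normrN ler_norm.
- by move=> _ [x ->]; exact: ray_sin.
- move=> k; rewrite [X in X < _]ray_sin.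
  apply: (@le_lt_trans _ _ (\int[mu]_x (I x)%:E)).
    apply: ge0_subset_integral => //.
    + by apply/measurable_EFinP.
    + by move=> x _; rewrite lee_fin.
  rewrite (_ : (fun x => _) = (fun x => (\1_(`](-1)%R, 1%R[%classic) x)%:E));
    last first.
    apply/funext => x; rewrite indicE /I; case: ifPn => x1.
      by rewrite mem_set//= in_itv.
    by rewrite memNset//= in_itv/=; exact/negP.
  rewrite integral_indic// setIT.
  suff : mu `](-1)%R, 1%R[%classic < +oo by [].
  rewrite lebesgue_measure_itv/= lte_fin.
  by case: ifP => _; rewrite ?ltry// -EFinD ltry.
Qed.

(** [x = cos theta] turns [sin^k theta dtheta] into [(1 - x^2)^((k-1)/2) dx]. *)
Lemma ge0_integral_cos (k : R) (h : mR -> \bar R) :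
  measurable_fun setT h -> (forall x, 0 <= h x) ->
  \int[mu]_x (h (cos x) * (if 0 < x < pi then sin x `^ k else 0)%R%:E)
  = \int[mu]_x (h x * (ppow ((k - 1) / 2) (1 - x ^+ 2))%:E).
Proof.
move=> mh h0.
have := @ge0_integral_cos_sin (fun x => h x * (ppow ((k - 1) / 2) (1 - x ^+ 2))%:E)
  _ _.
move=> H; transitivity (\int[mu]_x (h (cos x)
  * (ppow ((k - 1) / 2) (1 - cos x ^+ 2))%:E * (S x)%:E)).
  apply: eq_integral => x _; rewrite -muleA -EFinM; congr (_ * EFin _).
  rewrite /S; case: ifPn => x0; last by rewrite mulr0.
  have sx : (0 < sin x)%R by exact: sin_gt0_pi.
  rewrite -sin2cos2 ppow_gt0 ?exprn_gt0// -powR_mulrn ?ltW// -powRrM.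
  rewrite -[X in (_ * X)%R]powRr1 ?ltW// -powRD ?(gt_eqF sx) ?implybT//.
  by congr (_ `^ _)%R; field.
rewrite H.
- apply: eq_integral => x _; rewrite -muleA -EFinM; congr (_ * EFin _).
  rewrite /I; case: ifPn => x0; first by rewrite mulr1.
  rewrite mulr0 ppow_le0// subr_le0 -real_normK ?num_real// expr_ge1//.
  by move: x0; rewrite -ltr_norml -leNgt.
- apply: emeasurable_funM => //; apply/measurable_EFinP; apply: measurable_ppow_comp.
  by apply: measurable_funB => //; exact: measurable_funX.
- by move=> x; rewrite mule_ge0// lee_fin ppow_ge0.
Qed.

End cosine_substitution.

(** * The law of a projected direction *)
Section angles.
Context {R : realType}.
Local Notation mR := (measurableTypeR R).
Local Notation mu := (@lebesgue_measure R).
Local Notation leb := (lebesgue_tuple R).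
Local Open Scope ereal_scope.

Lemma measurable_tuple_nth p i : measurable_fun setT
  (fun s : p.-tuple mR => nth 0%R s i : mR).
Proof.
have [ip|pi] := ltnP i p.
  rewrite (_ : (fun w => _) = (fun x => tnth x (Ordinal ip)));
    first exact: measurable_tnth.
  by apply/funext => w /=; rewrite (tnth_nth 0%R).
rewrite (_ : (fun w => _) = cst 0%R); first exact: measurable_cst.
by apply/funext => w /=; rewrite nth_default// size_tuple.
Qed.

(** The first [m] coordinates of the unit vector with angles [th], numbered
    from 0: the coordinate [i] is
    [sin th_0 ... sin th_(i-1) cos th_i]. *)
Definition direction D m (th : D.-tuple mR) : m.-tuple mR :=
  [tuple ((\prod_(j < i) sin (nth 0 th j)) * cos (nth 0 th i))%R | i < m].

Lemma measurable_direction D m : measurable_fun setT (@direction D m).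
Proof.
apply/measurable_fun_tnthP => i.
rewrite (_ : _ \o _ = fun th : D.-tuple mR =>
  ((\prod_(j < i) sin (nth 0 th j)) * cos (nth 0 th i))%R); last first.
  by apply/funext => th /=; rewrite tnth_mktuple.
apply: measurable_funM.
  apply: measurable_prod => j _.
  exact: (measurableT_comp measurable_sin (measurable_tuple_nth _)).
exact: (measurableT_comp measurable_cos (measurable_tuple_nth _)).
Qed.

Lemma direction_cons D m x (s : D.-tuple mR) :
  direction m.+1 (cons_pair (x, s)) = cons_pair
    (cos x, scale_shift (sin x) (zero_tuple m) (direction m s)).
Proof.
apply: eq_from_tnth => i; rewrite tnth_mktuple.
case: (unliftP ord0 i) => [j ->|->]; last by rewrite tnth0 big_ord0 mul1r.
rewrite tnthS !tnth_mktuple /= addr0 big_ord_recl/= -mulrA; congr (_ * (_ * _))%R.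
Qed.

(** The angle density of dimension [D + 2] without its normalising constant.
    The [D + 1] angles are numbered from 0: those of index [j < D] range over
    [[0, pi]], with exponent [2 nu + D - j], and the last one over
    [[0, 2 pi]]. *)
Definition angle_weight D (nu : R) (th : D.+1.-tuple mR) : R :=
  (if [forall j : 'I_D, 0 <= nth 0 th j <= pi] && (0 <= nth 0 th D <= 2 * pi) then
    (\prod_(j < D) sin (nth 0 th j) `^ (2 * nu + D%:R - j%:R)) *
    `|sin (nth 0 th D)| `^ (2 * nu)
  else 0)%R.

Lemma angle_weight_ge0 D nu (th : D.+1.-tuple mR) : (0 <= angle_weight nu th)%R.
Proof.
rewrite /angle_weight; case: ifP => // _; rewrite mulr_ge0 ?powR_ge0//.
by apply: prodr_ge0 => j _; exact: powR_ge0.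
Qed.

(** The factor of [angle_weight] that comes from one angle in [[0, pi]]. *)
Definition polar_weight (k x : R) : R := (if 0 <= x <= pi then sin x `^ k else 0)%R.

Lemma angle_weight_cons D nu x (s : D.+1.-tuple mR) :
  angle_weight nu (cons_pair (x, s)) =
  (polar_weight (2 * nu + D.+1%:R) x * angle_weight nu s)%R.
Proof.
rewrite /angle_weight /polar_weight /=.
have -> : [forall j : 'I_D.+1, (0 <= nth 0 (x :: s) j <= pi)%R] =
    (0 <= x <= pi)%R && [forall j : 'I_D, (0 <= nth 0 s j <= pi)%R].
  apply/forallP/andP => [H|[x0 /forallP H] j].
    by split; [exact: (H ord0)|apply/forallP => j; exact: (H (lift ord0 j))].
  by case: (unliftP ord0 j) => [i ->|->//]; exact: H.
rewrite -andbA; case: (boolP (0 <= x <= pi)%R) => _ /=; last by rewrite mul0r.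
case: ifP => _; last by rewrite mulr0.
rewrite big_ord_recl/= subr0 -mulrA; congr (_ * (_ * _))%R.
by apply: eq_bigr => j _; congr (_ `^ _)%R; rewrite -natr1 /bump/= add1n -natr1; ring.
Qed.

Lemma measurable_powR_comp d (T : measurableType d) (k : R) (f : T -> R) :
  measurable_fun setT f -> measurable_fun setT (fun w => f w `^ k)%R.
Proof. by move=> mf; exact: (measurableT_comp (measurable_powR k)). Qed.

Lemma measurable_closed_between (a b : R) :
  measurable_fun setT (fun x : mR => (a <= x <= b)%R).
Proof.
apply: measurable_and.
  exact: (@measurable_fun_ler _ _ R setT (cst a) id).
exact: (@measurable_fun_ler _ _ R setT id (cst b)).
Qed.

Lemma measurable_polar_weight k : measurable_fun setT
  (fun x : mR => polar_weight k x).
Proof.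
apply: (@measurable_fun_ifT _ _ mR R (fun x => sin x `^ k)%R (cst 0%R)
  (fun x => 0 <= x <= pi)%R).
- exact: measurable_closed_between.
- apply: measurable_powR_comp; exact: measurable_sin.
- exact: measurable_cst.
Qed.

Lemma measurable_angle_weight D nu :
  measurable_fun setT (fun th => @angle_weight D nu th).
Proof.
elim: D => [|D IH].
  rewrite (_ : (fun th => _) = (fun x =>
    if (0 <= x <= 2 * pi)%R then (`|sin x| `^ (2 * nu))%R else 0%R) \o
      (fun th : 1.-tuple mR => nth 0%R th 0)); last first.
    apply/funext => th; rewrite /angle_weight /= big_ord0 mul1r.
    by rewrite (_ : [forall j, _] = true)//; apply/forallP => -[].
  apply: measurableT_comp; last exact: measurable_tuple_nth.
  apply: (@measurable_fun_ifT _ _ mR R (fun x => `|sin x| `^ (2 * nu))%R (cst 0%R)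
    (fun x => 0 <= x <= 2 * pi)%R).
  - exact: measurable_closed_between.
  - apply: measurable_powR_comp; apply: (measurableT_comp (@normr_measurable R setT)).
    exact: measurable_sin.
  - exact: measurable_cst.
rewrite (_ : (fun th => _) = (fun th : D.+2.-tuple mR =>
  polar_weight (2 * nu + D.+1%:R) (thead th) * angle_weight nu
    [tuple of behead th])%R); last first.
  by apply/funext => th; rewrite -angle_weight_cons [in LHS](tuple_eta th).
apply: measurable_funM.
  apply: (measurableT_comp (measurable_polar_weight _)).
  exact: measurable_tnth.
by apply: (measurableT_comp IH); exact: measurable_behead.
Qed.

Lemma measurable_scale_shift_comp d (T : measurableType d) n (k : T -> R)
  (a x : T -> n.-tuple mR) :
  measurable_fun setT k -> measurable_fun setT a -> measurable_fun setT x ->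
  measurable_fun setT (fun w => scale_shift (k w) (a w) (x w)).
Proof.
move=> mk ma mx; apply/measurable_fun_tnthP => i.
rewrite (_ : _ \o _ = fun w => (k w * tnth (x w) i + tnth (a w) i)%R); last first.
  by apply/funext => w /=; rewrite tnth_mktuple.
apply: measurable_funD; last exact: (measurableT_comp (measurable_tnth _)).
apply: measurable_funM => //.
by apply: (measurableT_comp (measurable_tnth _)).
Qed.

(** The dilation by [k] in an integral against a truncated power. *)
Lemma ge0_integral_ball_scale m (e w k : R) (g : m.-tuple mR -> \bar R) :
  (0 < k)%R -> measurable_fun setT g -> (forall v, 0 <= g v) ->
  \int[leb m]_v (g (scale_shift k (zero_tuple m) v) * (ppow e (w - sqnorm v))%:E)
  = (k `^ (- (2 * e + m%:R)))%:E *
    \int[leb m]_v (g v * (ppow e (k ^+ 2 * w - sqnorm v))%:E).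
Proof.
move=> k0 mg g0; have k2 : (k ^+ 2 != 0)%R by rewrite expf_neq0// gt_eqF.
pose f (v : m.-tuple mR) := g v * (ppow e (w - k ^- 2 * sqnorm v))%:E.
have mf : measurable_fun setT f.
  apply: emeasurable_funM => //; apply/measurable_EFinP; apply: measurable_ppow_comp.
  apply: measurable_funB => //.
  by apply: measurable_funM => //; exact: measurable_sqnorm.
have f0 v : 0 <= f v by rewrite mule_ge0// lee_fin ppow_ge0.
transitivity (\int[leb m]_v f (scale_shift k (zero_tuple m) v)).
  by apply: eq_integral => v _; rewrite /f sqnorm_scale mulrA mulVf ?mul1r.
rewrite (ge0_integral_scale_shift (zero_tuple m) k0 mf f0).
have -> : \int[leb m]_v f v = (k `^ (- 2 * e))%:E *
    \int[leb m]_v (g v * (ppow e (k ^+ 2 * w - sqnorm v))%:E).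
  rewrite -ge0_integralZl//; last 3 first.
  - apply: emeasurable_funM => //; apply/measurable_EFinP;
      apply: measurable_ppow_comp.
    by apply: measurable_funB => //; exact: measurable_sqnorm.
  - by move=> v _; rewrite mule_ge0// lee_fin ppow_ge0.
  - by rewrite lee_fin powR_ge0.
  apply: eq_integral => v _; rewrite muleCA; congr (_ * _).
  rewrite -EFinM; congr EFin.
  rewrite (_ : w - _ = k ^- 2 * (k ^+ 2 * w - sqnorm v))%R; last first.
    by rewrite mulrBr mulKf.
  rewrite ppowM ?invr_gt0 ?exprn_gt0//; congr (_ * _)%R.
  by rewrite -powR_mulrn ?ltW// -powRN -powRrM.
rewrite muleA -EFinM -powR_mulrn ?ltW// -powRN -powRD ?(gt_eqF k0) ?implybT//.
by congr ((_ `^ _)%:E * _); ring.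
Qed.

(** Away from [0], [p] and [2 p], the segment [[0, 2 p]] is the disjoint union
    of (0, p) and its image under [x |-> 2 p - x]. *)
Lemma two_arcs (p x : R) : (0 < p)%R -> x != 0%R -> x != p -> (x != 2 * p)%R ->
  [\/ [/\ (0 <= x <= 2 * p)%R, (0 < x < p)%R & (0 < - x + 2 * p < p)%R = false],
      [/\ (0 <= x <= 2 * p)%R, (0 < x < p)%R = false & (0 < - x + 2 * p < p)%R] |
      [/\ (0 <= x <= 2 * p)%R = false, (0 < x < p)%R = false
        & (0 < - x + 2 * p < p)%R = false]].
Proof.
move=> p0; rewrite !neq_lt => /orP[x0|x0] /orP[xp|xp] /orP[x2|x2]; try (exfalso; lra).
- apply: Or33; split; apply/negbTE; rewrite negb_and -?leNgt -?ltNge; apply/orP.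
  + by left.
  + by left; exact: ltW.
  + by right; lra.
- apply: Or31; split; [lra|lra|].
  by apply/negbTE; rewrite negb_and -!leNgt; apply/orP; right; lra.
- apply: Or32; split; [lra| |lra].
  by apply/negbTE; rewrite negb_and -!leNgt; apply/orP; right; exact: ltW.
- apply: Or33; split; apply/negbTE; rewrite negb_and -?leNgt -?ltNge; apply/orP.
  + by right.
  + by right; exact: ltW.
  + by left; lra.
Qed.

(** The last angle describes a full circle, each half of which is mapped by
    [cos] onto [[-1, 1]]; hence the factor 2. *)
Lemma ge0_integral_last_angle nu (h : mR -> \bar R) :
  measurable_fun setT h -> (forall x, 0 <= h x) ->
  \int[mu]_x (h (cos x) * (if 0 <= x <= 2 * pi then `|sin x| `^ (2 * nu) else 0)%R%:E)
  = 2%:E * \int[mu]_x (h x * (ppow (nu - 2^-1) (1 - x ^+ 2))%:E).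
Proof.
move=> mh h0.
pose F (x : mR) : R := (if 0 < x < pi then sin x `^ (2 * nu) else 0)%R.
have mF : measurable_fun setT F.
  apply: (@measurable_fun_ifT _ _ mR R (fun x => sin x `^ (2 * nu))%R (cst 0%R)
    (fun x => 0 < x < pi)%R).
  - exact: measurable_between.
  - apply: measurable_powR_comp; exact: measurable_sin.
  - exact: measurable_cst.
have F0 x : (0 <= F x)%R by rewrite /F; case: ifP => // _; exact: powR_ge0.
pose G (x : mR) := h (cos x) * (F x)%:E.
have mG : measurable_fun setT G.
  apply: emeasurable_funM; first exact: (measurableT_comp mh measurable_cos).
  exact/measurable_EFinP.
have G0 x : 0 <= G x by rewrite mule_ge0// lee_fin.
transitivity (\int[mu]_x (G x + G (-1 * x + 2 * pi)%R)).
  apply: ge0_ae_eq_integral => //.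
  - apply: emeasurable_funM; first exact: (measurableT_comp mh measurable_cos).
    apply/measurable_EFinP.
    apply: (@measurable_fun_ifT _ _ mR R (fun x => `|sin x| `^ (2 * nu))%R (cst 0%R)
      (fun x => 0 <= x <= 2 * pi)%R).
    + exact: measurable_closed_between.
    + apply: measurable_powR_comp; apply: (measurableT_comp
        (@normr_measurable R setT)).
      exact: measurable_sin.
    + exact: measurable_cst.
  - apply: emeasurable_funD => //.
    by apply: (measurableT_comp mG); exact: measurable_affine.
  - by move=> x _; rewrite mule_ge0// lee_fin; case: ifP => // _; exact: powR_ge0.
  - by move=> x _; rewrite adde_ge0.
  (* The two integrands may differ at 0, pi and 2 pi, in particular for
     [nu = 0], where [0 `^ 0 = 1]. *)
  exists ([set 0%R] `|` [set pi] `|` [set (2 * pi)%R]); split.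
  - by apply: measurableU; [apply: measurableU|]; exact: measurable_set1.
  - apply: countable_lebesgue_measure0; apply: finite_set_countable.
    by rewrite !finite_setU.
  move=> x /= H; apply: contrapT => /= xN; apply: H => _.
  have [x0 xp x2p] : [/\ x != 0, x != pi & x != 2 * pi]%R.
    by split; apply/eqP => e; apply: xN; [left; left|left; right|right].
  have -> : G (-1 * x + 2 * pi)%R = h (cos x) * (F (-1 * x + 2 * pi)%R)%:E.
    by rewrite /G mulN1r addrC mulr_natl cosB cos2pi sin2pi mul1r mul0r addr0.
  rewrite /G -ge0_muleDr ?lee_fin//; congr (_ * _).
  rewrite -EFinD; congr EFin; rewrite mulN1r /F.
  have [[-> x1 ->]|[-> -> x1]|[-> -> ->]] := two_arcs (@pi_gt0 R) x0 xp x2p.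
  - by rewrite x1 addr0 gtr0_norm// sin_gt0_pi.
  - rewrite x1 add0r (_ : sin x = - sin (- x + 2 * pi))%R.
      by rewrite normrN gtr0_norm// sin_gt0_pi.
    by rewrite addrC mulr_natl sinB sin2pi cos2pi mul0r mul1r add0r opprK.
  - by rewrite addr0.
rewrite ge0_integralD//; last first.
  by apply: (measurableT_comp mG); exact: measurable_affine.
rewrite ge0_integral_affine// ?oppr_eq0// normrN1 invr1 mul1e.
have -> : \int[mu]_x G x = \int[mu]_x (h x * (ppow (nu - 2^-1) (1 - x ^+ 2))%:E).
  rewrite [LHS](ge0_integral_cos (2 * nu) mh h0).
  apply: eq_integral => x _.
  by congr (_ * (ppow _ _)%:E); field.
by rewrite -[2%R]/(1 + 1)%R EFinD ge0_muleDl ?lee_fin// !mul1e.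
Qed.

(** With [theta] the first angle, the coordinates after the first are
    [sin theta] times a direction with one angle fewer.  By induction they
    have, given [theta], a density proportional to
    [(sin^2 theta - |v|^2)^e] on the ball of radius [sin theta], which is the
    slice of the unit ball where the first coordinate is [cos theta]. *)
Lemma angle_projection D m nu : (0 <= nu)%R -> (m <= D.+1)%N ->
  exists2 K : \bar R, 0 <= K & forall g : m.-tuple mR -> \bar R,
    measurable_fun setT g -> (forall v, 0 <= g v) ->
    \int[leb D.+1]_th (g (direction m th) * (angle_weight nu th)%:E)
    = K * \int[leb m]_v (g v * (ppow (nu + (D%:R - m%:R) / 2) (1 - sqnorm v))%:E).
Proof.
move=> nu0.
(* With no coordinate the constant is the total weight of the angles. *)
have case0 D' : (0 <= D'.+1)%N ->
  exists2 K : \bar R, 0 <= K & forall g : 0.-tuple mR -> \bar R,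
    measurable_fun setT g -> (forall v, 0 <= g v) ->
    \int[leb D'.+1]_th (g (direction 0 th) * (angle_weight nu th)%:E)
    = K * \int[leb 0]_v (g v * (ppow (nu + (D'%:R - 0%:R) / 2) (1 - sqnorm v))%:E).
  move=> _; exists (\int[leb D'.+1]_th (angle_weight nu th)%:E) => [|g mg g0].
    by apply: integral_ge0 => th _; rewrite lee_fin angle_weight_ge0.
  rewrite integral_lebesgue_tuple0.
  have -> : (1 - @sqnorm R 0 [tuple] = 1)%R by rewrite /sqnorm big_ord0 subr0.
  rewrite ppow_gt0// powR1 mule1 -ge0_integralZr//.
  - by apply: eq_integral => th _; rewrite muleC (tuple0 (direction 0 th)).
  - by apply/measurable_EFinP; exact: measurable_angle_weight.
  - by move=> th _; rewrite lee_fin angle_weight_ge0.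
elim: D m => [|D IH] [|m].
- exact: case0.
- rewrite ltnS leqn0 => /eqP ->; exists 2%:E => [|g mg g0]; first by rewrite lee_fin.
  have mc : measurable_fun setT (fun x : mR => cons_pair (x, [tuple]) : 1.-tuple mR).
    apply: (measurableT_comp (@measurable_cons_pair R 0)).
    by apply: measurable_fun_pair => //; exact: measurable_cst.
  pose h (x : mR) := g (cons_pair (x, [tuple])).
  have mh : measurable_fun setT h by exact: (measurableT_comp mg mc).
  rewrite integral_lebesgue_tupleS; last 2 first.
  - apply: emeasurable_funM.
      by apply: (measurableT_comp mg); exact: measurable_direction.
    by apply/measurable_EFinP; exact: measurable_angle_weight.
  - by move=> th; rewrite mule_ge0// lee_fin angle_weight_ge0.
  transitivity (\int[mu]_x (h (cos x)
    * (if 0 <= x <= 2 * pi then `|sin x| `^ (2 * nu) else 0)%R%:E)).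
    apply: eq_integral => x _; rewrite integral_lebesgue_tuple0.
    congr (g _ * _%:E).
      by rewrite direction_cons; congr (cons_pair (_, _)); exact: tuple0.
    rewrite /angle_weight /= big_ord0 mul1r.
    by rewrite (_ : [forall j, _] = true)//; apply/forallP => -[].
  rewrite ge0_integral_last_angle//; last by move=> x; exact: g0.
  congr (_ * _).
  rewrite integral_lebesgue_tupleS; last 2 first.
  - apply: emeasurable_funM => //; apply/measurable_EFinP;
      apply: measurable_ppow_comp.
    by apply: measurable_funB => //; exact: measurable_sqnorm.
  - by move=> v; rewrite mule_ge0// lee_fin ppow_ge0.
  apply: eq_integral => x _; rewrite integral_lebesgue_tuple0.
  by rewrite /h sqnorm_cons /sqnorm big_ord0 addr0; congr (_ * (ppow _ _)%:E); field.
- exact: case0.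
rewrite ltnS => mD; have [K K0 IHK] := IH _ mD.
exists K => // g mg g0.
set e := (nu + (D%:R - m%:R) / 2)%R in IHK *.
have -> : (nu + (D.+1%:R - m.+1%:R) / 2 = e)%R.
  by rewrite /e -!natr1 opprD addrACA subrr addr0.
(* [k] is the exponent of the first angle.  The dilation by its sine
   contributes the power [- (2 e + m) = 1 - k], so that only
   [sin theta dtheta], the measure of [x = cos theta], remains. *)
pose k := (2 * nu + D.+1%:R)%R.
have k0 : (0 < k)%R by rewrite ltr_wpDl ?mulr_ge0.
(* The integral over the slice where the first coordinate is [y]. *)
pose Phi (y : mR) := \int[leb m]_v (g (cons_pair (y, v))
  * (ppow e (1 - y ^+ 2 - sqnorm v))%:E).
have mPhi2 : measurable_fun setT (fun z : mR * m.-tuple mR =>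
    g (cons_pair (z.1, z.2)) * (ppow e (1 - z.1 ^+ 2 - sqnorm z.2))%:E).
  apply: emeasurable_funM.
    apply: (measurableT_comp mg); rewrite (_ : (fun z => _) = @cons_pair R m);
      last by apply/funext => -[].
    exact: measurable_cons_pair.
  apply/measurable_EFinP; apply: measurable_ppow_comp; apply: measurable_funB.
    by apply: measurable_funB => //; exact: measurable_funX.
  exact: (measurableT_comp (@measurable_sqnorm R m)).
have Phi20 y v : 0 <= g (cons_pair (y, v)) * (ppow e (1 - y ^+ 2 - sqnorm v))%:E.
  by rewrite mule_ge0// lee_fin ppow_ge0.
have mPhi : measurable_fun setT Phi by exact: (measurable_fun_ge0_integral (leb m)
  mPhi2).
have Phi0 y : 0 <= Phi y by exact: integral_ge0.
rewrite integral_lebesgue_tupleS; last 2 first.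
- apply: emeasurable_funM.
    by apply: (measurableT_comp mg); exact: measurable_direction.
  by apply/measurable_EFinP; exact: measurable_angle_weight.
- by move=> th; rewrite mule_ge0// lee_fin angle_weight_ge0.
transitivity (\int[mu]_x (K * (Phi (cos x)
  * (if 0 < x < pi then sin x `^ 1 else 0)%R%:E))).
  apply: eq_integral => x _.
  have mgx : measurable_fun setT (fun v =>
    g (cons_pair (cos x, scale_shift (sin x) (zero_tuple m) v))).
    apply: (measurableT_comp mg); apply: (measurableT_comp
      (@measurable_cons_pair R m)).
    by apply: measurable_fun_pair => //; exact: measurable_scale_shift.
  transitivity (\int[leb D.+1]_s ((polar_weight k x)%:E *
     (g (cons_pair (cos x, scale_shift (sin x) (zero_tuple m) (direction m s)))
       * (angle_weight nu s)%:E))).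
    by apply: eq_integral => s _; rewrite direction_cons angle_weight_cons EFinM
      muleCA.
  rewrite ge0_integralZl//; last 3 first.
  - apply: emeasurable_funM; last by apply/measurable_EFinP;
      exact: measurable_angle_weight.
    by apply: (measurableT_comp mgx); exact: measurable_direction.
  - by move=> s _; rewrite mule_ge0// lee_fin angle_weight_ge0.
  - by rewrite lee_fin /polar_weight; case: ifP => // _; exact: powR_ge0.
  rewrite (IHK (fun v => g (cons_pair
    (cos x, scale_shift (sin x) (zero_tuple m) v))))//.
  rewrite muleCA; congr (_ * _).
  have [x0|x0] := boolP (0 < x < pi)%R; last first.
    (* At the endpoints 0 and pi the weight vanishes, as [k > 0]. *)
    rewrite mule0 /polar_weight; case: ifPn => xp; last by rewrite mul0e.
    have sx : sin x = 0%R.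
      have [->|xn0] := eqVneq x 0%R; first exact: sin0.
      have [->|xnp] := eqVneq x pi; first exact: sinpi.
      exfalso; move/negP: x0; apply; move/andP: xp => [x1 x2].
      by rewrite !lt_neqAle eq_sym xn0 x1 xnp x2.
    by rewrite sx powR0 ?gt_eqF// mul0e.
  have sx : (0 < sin x)%R by exact: sin_gt0_pi.
  have mgc : measurable_fun setT (fun v => g (cons_pair (cos x, v))).
    apply: (measurableT_comp mg); apply: (measurableT_comp
      (@measurable_cons_pair R m)).
    exact: measurable_pair1.
  rewrite (ge0_integral_ball_scale e 1 sx mgc (fun _ => g0 _)) mulr1.
  rewrite muleA -EFinM muleC sin2cos2; congr (_ * EFin _).
  rewrite /polar_weight ifT; last by case/andP: x0 => x1 x2; rewrite !ltW.
  rewrite -powRD ?(gt_eqF sx) ?implybT//.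
  by congr (_ `^ _)%R; rewrite /k /e -natr1; field.
rewrite ge0_integralZl//; last 2 first.
- apply: emeasurable_funM; first by apply: (measurableT_comp mPhi);
    exact: measurable_cos.
  apply/measurable_EFinP.
  apply: (@measurable_fun_ifT _ _ mR R (fun x => sin x `^ 1)%R (cst 0%R)
    (fun x => 0 < x < pi)%R).
  + exact: measurable_between.
  + apply: measurable_powR_comp; exact: measurable_sin.
  + exact: measurable_cst.
- by move=> x _; rewrite mule_ge0// lee_fin; case: ifP => // _; exact: powR_ge0.
rewrite (ge0_integral_cos 1 mPhi Phi0); congr (_ * _).
rewrite integral_lebesgue_tupleS; last 2 first.
- apply: emeasurable_funM => //; apply/measurable_EFinP; apply: measurable_ppow_comp.
  by apply: measurable_funB => //; exact: measurable_sqnorm.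
- by move=> v; rewrite mule_ge0// lee_fin ppow_ge0.
apply: eq_integral => y _.
transitivity (Phi y); last first.
  by apply: eq_integral => v _; rewrite sqnorm_cons opprD addrA.
have [y1|y1] := ltP 0%R (1 - y ^+ 2)%R.
  by rewrite ppow_gt0// subrr mul0r powRr0 mule1.
rewrite (ppow_le0 _ y1) mule0; apply/esym/integral0_eq => v _.
by rewrite ppow_le0 ?mule0// subr_le0 (le_trans y1)// sqnorm_ge0.
Qed.

End angles.

(** * Independent draws and linear combinations *)
Section iid.
Context d (T : measurableType d) (R : realType) (P : probability T R).
Local Open Scope ereal_scope.

(** The analogue of [cons_pair] over an arbitrary measurable type. *)
Definition tuple_cons n (p : T * n.-tuple T) : n.+1.-tuple T := [tuple of p.1 :: p.2].

Lemma measurable_tuple_cons n : measurable_fun setT (@tuple_cons n).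
Proof. exact: measurable_cons. Qed.

HB.instance Definition _ n :=
  isMeasurableFun.Build _ _ _ _ (@tuple_cons n) (@measurable_tuple_cons n).

(** The law of [n] independent draws from [P]. *)
Fixpoint iid n : probability (n.-tuple T) R :=
  match n with
  | 0 => dirac ([tuple] : 0.-tuple T)
  | n.+1 => distribution (P \x iid n) (@tuple_cons n)
  end.

Lemma integral_iidS n (f : n.+1.-tuple T -> \bar R) :
  measurable_fun setT f -> (forall x, 0 <= f x) ->
  \int[iid n.+1]_x f x = \int[P]_x \int[iid n]_s f (tuple_cons (x, s)).
Proof.
move=> mf f0.
rewrite [LHS](ge0_integral_pushforward (@measurable_tuple_cons n) (P \x iid n))//.
rewrite preimage_setT (@fubini_tonelli1 _ _ _ _ R P (iid n) (f \o @tuple_cons n))//.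
  by apply: measurableT_comp => //; exact: measurable_tuple_cons.
by move=> x; exact: f0.
Qed.

Lemma integral_iid0 (f : 0.-tuple T -> \bar R) : \int[iid 0]_x f x = f [tuple].
Proof.
by rewrite integral_dirac ?diracT ?mul1e//; exact: measurable_fun0tuple.
Qed.

End iid.

Section linear_combination.
Context {R : realType}.
Local Notation mR := (measurableTypeR R).
Local Notation leb := (lebesgue_tuple R).
Local Open Scope ereal_scope.

(** The sum of the vectors [ts_k vs_k]. *)
Definition lincomb m n (ts : n.-tuple mR) (vs : n.-tuple (m.-tuple mR)) :
  m.-tuple mR :=
  [tuple (\sum_(k < n) tnth ts k * tnth (tnth vs k) i)%R | i < m].

Lemma measurable_lincomb m n d (T : measurableType d)
    (ts : T -> n.-tuple mR) (vs : T -> n.-tuple (m.-tuple mR)) :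
  measurable_fun setT ts -> measurable_fun setT vs ->
  measurable_fun setT (fun w => lincomb (ts w) (vs w)).
Proof.
move=> mts mvs; apply/measurable_fun_tnthP => i.
rewrite (_ : _ \o _ = fun w => (\sum_(k < n) tnth (ts w) k * tnth (tnth (vs w) k)
  i)%R); last first.
  by apply/funext => w /=; rewrite tnth_mktuple.
apply: measurable_sum => k; apply: measurable_funM.
  exact: (measurableT_comp (measurable_tnth _)).
apply: (measurableT_comp (measurable_tnth _)).
exact: (measurableT_comp (measurable_tnth _)).
Qed.

Lemma lincomb_cons m n t (ts : n.-tuple mR) v (vs : n.-tuple (m.-tuple mR)) :
  lincomb (cons_pair (t, ts)) (tuple_cons (v, vs)) = scale_shift t (lincomb ts vs) v.
Proof.
apply: eq_from_tnth => i; rewrite !tnth_mktuple big_ord_recl !tnth0; congr (_ + _)%R.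
by apply: eq_bigr => k _; rewrite !tnthS.
Qed.

(** After a first duration [t], the others fill the remaining time [s - t]. *)
Lemma durations_cons n s t (u : n.-tuple mR) :
  durations s (cons_pair (t, u)) = cons_pair (t, durations (s - t) u) :> _.-tuple mR.
Proof. by apply: val_inj => /=; rewrite big_cons opprD addrA. Qed.

Lemma durations0 s : durations s [tuple] = cons_pair (s, [tuple]) :> 1.-tuple mR.
Proof. by apply: val_inj => /=; rewrite big_nil subr0. Qed.

Lemma measurable_durations n d (T : measurableType d) (s : T -> R)
  (u : T -> n.-tuple mR) :
  measurable_fun setT s -> measurable_fun setT u ->
  measurable_fun setT (fun w => durations (s w) (u w) : n.+1.-tuple mR).
Proof.
elim: n s u => [|n IH] s u ms mu.
  apply/measurable_fun_tnthP => i; rewrite (_ : _ \o _ = s)//.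
  by apply/funext => w /=; rewrite (tuple0 (u w)) ord1 (tnth_nth 0%R)/= big_nil subr0.
have mh : measurable_fun setT (fun w => thead (u w))
  by exact: (measurableT_comp (measurable_tnth _)).
rewrite (_ : (fun w => _) = fun w => cons_pair (thead (u w),
    durations (s w - thead (u w)) [tuple of behead (u w)] : n.+1.-tuple mR)%R);
      last first.
  by apply/funext => w; rewrite -durations_cons [in LHS](tuple_eta (u w)).
apply: (measurableT_comp (@measurable_cons_pair R n.+1)).
apply: measurable_fun_pair => //; apply: IH; first exact: measurable_funB.
by apply: (measurableT_comp (@measurable_behead _ _ _)).
Qed.

(** The product of the powers of exponent [a] of the [n + 1] durations with sum
    [s]; the powers being truncated, it vanishes unless all durations are
    positive. *)
Definition duration_weight n a s (u : n.-tuple mR) : R :=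
  (\prod_(k < n.+1) ppow a (tnth (durations s u) k))%R.

Lemma duration_weight_ge0 n a s (u : n.-tuple mR) : (0 <= duration_weight a s u)%R.
Proof. by apply: prodr_ge0 => k _; exact: ppow_ge0. Qed.

Lemma duration_weight_cons n a s t (u : n.-tuple mR) :
  duration_weight a s (cons_pair (t, u)) = (ppow a t * duration_weight a (s - t) u)%R.
Proof.
rewrite /duration_weight durations_cons big_ord_recl tnth0; congr (_ * _)%R.
by apply: eq_bigr => k _; rewrite tnthS.
Qed.

Lemma measurable_duration_weight n a d (T : measurableType d) (s : T -> R)
  (u : T -> n.-tuple mR) :
  measurable_fun setT s -> measurable_fun setT u ->
  measurable_fun setT (fun w => duration_weight a (s w) (u w)).
Proof.
move=> ms mu; apply: measurable_prod => k _; apply: measurable_ppow_comp.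
apply: (measurableT_comp (measurable_tnth k)).
exact: measurable_durations.
Qed.

End linear_combination.

(** * Induction on the number of segments *)
(** Here [rho] is a law on R^m with density proportional to
    [(1 - |v|^2)^p]. *)
Section convolution.
Context {R : realType} (N : nat).
Local Notation m := N.+1.
Local Notation mR := (measurableTypeR R).
Local Notation mu := (@lebesgue_measure R).
Local Notation leb := (lebesgue_tuple R).
Local Open Scope ereal_scope.
Variables (rho : probability (m.-tuple mR) R) (p : R) (K : \bar R).
Hypothesis K0 : 0 <= K.
Hypothesis rhoE : forall g : m.-tuple mR -> \bar R,
  measurable_fun setT g -> (forall v, 0 <= g v) ->
  \int[rho]_v g v = K * \int[leb m]_v (g v * (ppow p (1 - sqnorm v))%:E).

Let a := (2 * p + m%:R)%R.

(** [s^a] times the law of [s V], with [V] of law [rho], has the cone kernel as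
    density up to the constant [K]: with [a = 2 p + m] the powers of [s]
    coming from the dilation cancel. *)
Lemma integral_one_step (s : R) (g : m.-tuple mR -> \bar R) :
  measurable_fun setT g -> (forall v, 0 <= g v) ->
  (ppow a s)%:E * \int[rho]_v g (scale_shift s (zero_tuple m) v)
  = K * \int[leb m]_x (g x * (cone p s x)%:E).
Proof.
move=> mg g0; have [s0|s0] := leP s 0%R.
  rewrite (ppow_le0 _ s0) mul0e (_ : \int[leb m]_x _ = 0) ?mule0//.
  by apply: integral0_eq => x _; rewrite /cone ltNge s0/= mule0.
rewrite rhoE//; last by apply: (measurableT_comp mg); exact: measurable_scale_shift.
rewrite ge0_integral_ball_scale// mulr1 muleCA; congr (_ * _).
rewrite muleA -EFinM ppow_gt0// -powRD ?(gt_eqF s0) ?implybT// subrr powRr0 mul1e.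
by apply: eq_integral => x _; rewrite /cone s0.
Qed.

(** The exponent of the [n + 1]-fold convolution of [cone p]. *)
Definition conv_exponent n : R := (n.+1%:R / 2 * (a + 1) - (m%:R + 1) / 2)%R.

Lemma conv_exponent0 : conv_exponent 0 = p.
Proof. by rewrite /conv_exponent /a; field. Qed.

Lemma conv_exponentS n : (p + conv_exponent n + (m%:R + 1) / 2 = conv_exponent
  n.+1)%R.
Proof. by rewrite /conv_exponent /a -[n.+2%:R]natr1; field. Qed.

Lemma measurable_lincomb_integral n d (T : measurableType d)
  (g : m.-tuple mR -> \bar R)
    (h : T -> m.-tuple mR -> m.-tuple mR) (ts : T -> n.-tuple mR) :
  measurable_fun setT g -> (forall v, 0 <= g v) ->
  measurable_fun setT (fun z : T * m.-tuple mR => h z.1 z.2) ->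
  measurable_fun setT ts ->
  measurable_fun setT (fun w => \int[iid rho n]_vs g (h w (lincomb (ts w) vs))).
Proof.
move=> mg g0 mh mts; apply: measurable_fun_ge0_integral => //.
apply: (measurableT_comp mg).
apply: (measurableT_comp mh (g := fun z : T * n.-tuple (m.-tuple mR) =>
  (z.1, lincomb (ts z.1) z.2))).
apply: measurable_fun_pair => //; apply: measurable_lincomb => //.
exact: (measurableT_comp mts).
Qed.

(** The sum of [n + 1] independent vectors of law [rho] multiplied by durations
    with sum [s], integrated against [duration_weight].  Splitting off the
    first duration and the first vector writes this as the convolution of the
    result for [n] segments with the cone kernel of one segment.  The constant
    [C] depends neither on [s] nor on [g]. *)
Lemma integral_duration_weight n : exists2 C : \bar R, 0 <= C &
  forall (s : R) (g : m.-tuple mR -> \bar R),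
  measurable_fun setT g -> (forall v, 0 <= g v) ->
  \int[leb n]_u ((duration_weight a s u)%:E *
    \int[iid rho n.+1]_vs g (lincomb (durations s u) vs))
  = C * \int[leb m]_x (g x * (cone (conv_exponent n) s x)%:E).
Proof.
elim: n => [|n [C C0 IH]].
  exists K => // s g mg g0; rewrite conv_exponent0 -integral_one_step//.
  rewrite integral_lebesgue_tuple0.
  have -> : duration_weight a s [tuple] = ppow a s.
    by rewrite /duration_weight durations0 big_ord_recl big_ord0 mulr1 tnth0.
  apply: (congr1 (fun z => (ppow a s)%:E * z)).
  have mgl : measurable_fun setT (fun vs : 1.-tuple (m.-tuple mR) =>
      g (lincomb (durations s [tuple]) vs)).
    apply: (measurableT_comp mg); apply: measurable_lincomb;
      last exact: measurable_id.
    exact: (@measurable_cst _ _ _ _ _ (durations s [tuple] : 1.-tuple mR)).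
  rewrite integral_iidS//; apply: eq_integral => v _.
  rewrite integral_iid0.
  rewrite durations0 lincomb_cons; congr (g (scale_shift _ _ _)).
  by apply: eq_from_tnth => i; rewrite !tnth_mktuple big_ord0.
exists (C * (K * riesz_constant N p (conv_exponent n))) => [|s g mg g0].
  by apply: mule_ge0 => //; apply: mule_ge0 => //; exact: riesz_constant_ge0.
set q := conv_exponent n in IH *.
have mgl d (T : measurableType d) (ts : T -> n.+2.-tuple mR) :
  measurable_fun setT ts ->
    measurable_fun setT (fun w => \int[iid rho n.+2]_vs g (lincomb (ts w) vs)).
  move=> mts; apply: (@measurable_lincomb_integral _ _ _ g (fun _ x => x)) => //.
  exact: measurable_snd.
rewrite integral_lebesgue_tupleS; last 2 first.
- apply: emeasurable_funM.
    apply/measurable_EFinP; exact: measurable_duration_weight.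
  by apply: mgl; exact: measurable_durations.
- by move=> u; rewrite mule_ge0 ?lee_fin ?duration_weight_ge0// integral_ge0.
(* By induction, the contribution of the remaining segments when the first one
   has duration [t] and ends at [y]. *)
pose G (t : R) (y : m.-tuple mR) :=
  \int[leb m]_z (g z * (cone q (s - t) (scale_shift (-1) z y))%:E).
have mG3 : measurable_fun setT (fun w : (mR * m.-tuple mR) * m.-tuple mR =>
    g w.2 * (cone q (s - w.1.1) (scale_shift (-1) w.2 w.1.2))%:E).
  apply: emeasurable_funM; first exact: (measurableT_comp mg).
  apply/measurable_EFinP; apply: measurable_cone.
    by apply: measurable_funB => //; exact: (measurableT_comp measurable_fst).
  by apply: measurable_scale_shift_comp => //;
    exact: (measurableT_comp measurable_snd).
have G30 t y z : 0 <= g z * (cone q (s - t) (scale_shift (-1) z y))%:E.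
  by rewrite mule_ge0// lee_fin cone_ge0.
have mG : measurable_fun setT (fun w : mR * m.-tuple mR => G w.1 w.2).
  exact: (measurable_fun_ge0_integral (leb m) mG3).
have G0 t y : 0 <= G t y by exact: integral_ge0.
transitivity (\int[mu]_t (C * (K * \int[leb m]_y (G t y * (cone p t y)%:E)))).
  apply: eq_integral => t _.
  have mh : measurable_fun setT (fun z :
    (n.-tuple mR * m.-tuple mR) * m.-tuple mR => scale_shift t z.2 z.1.2).
    by apply: measurable_scale_shift_comp => //;
      exact: (measurableT_comp measurable_snd).
  have md : measurable_fun setT (fun z : n.-tuple mR * m.-tuple mR =>
      durations (s - t) z.1 : n.+1.-tuple mR) by exact: measurable_durations.
  have mF : measurable_fun setT (fun z : n.-tuple mR * m.-tuple mR =>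
      (duration_weight a (s - t) z.1)%:E *
      \int[iid rho n.+1]_vs g (scale_shift t (lincomb (durations (s - t) z.1) vs)
        z.2)).
    apply: emeasurable_funM.
      by apply/measurable_EFinP; exact: measurable_duration_weight.
    exact: (@measurable_lincomb_integral _ _ _ g (fun z x => scale_shift t x z.2)).
  have F0 u v : 0 <= (duration_weight a (s - t) u)%:E *
      \int[iid rho n.+1]_vs g (scale_shift t (lincomb (durations (s - t) u) vs) v).
    by rewrite mule_ge0 ?lee_fin ?duration_weight_ge0// integral_ge0.
  transitivity ((ppow a t)%:E * \int[rho]_v \int[leb n]_u
    ((duration_weight a (s - t) u)%:E *
      \int[iid rho n.+1]_vs g (scale_shift t (lincomb (durations (s - t) u) vs) v))).
    rewrite -(ge0_integral_swap (leb n) rho mF F0).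
    rewrite -ge0_integralZl//; last 3 first.
    - exact: (measurable_fun_ge0_integral rho mF).
    - by move=> u _; exact: integral_ge0.
    - by rewrite lee_fin ppow_ge0.
    apply: eq_integral => u _.
    rewrite duration_weight_cons EFinM -muleA; congr (_ * _).
    rewrite ge0_integralZl//; last 3 first.
    - apply: (@measurable_lincomb_integral _ _ _ g
        (fun z x => scale_shift t x z)) => //.
      by apply: measurable_scale_shift_comp.
    - by move=> v _; exact: integral_ge0.
    - by rewrite lee_fin duration_weight_ge0.
    apply: (congr1 (fun z => (duration_weight a (s - t) u)%:E * z)).
    have mgd : measurable_fun setT (fun vs : n.+2.-tuple (m.-tuple mR) =>
        g (lincomb (durations s (cons_pair (t, u))) vs)).
      by apply: (measurableT_comp mg); exact: measurable_lincomb.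
    refine (etrans (integral_iidS rho mgd (fun _ => g0 _)) _).
    apply: eq_integral => v _; apply: eq_integral => vs _.
    by rewrite durations_cons lincomb_cons.
  transitivity ((ppow a t)%:E * \int[rho]_v
    (C * G t (scale_shift t (zero_tuple m) v))).
    apply: (congr1 (fun z => (ppow a t)%:E * z)); apply: eq_integral => v _.
    have mgv : measurable_fun setT (fun x => g (scale_shift t x v)).
      by apply: (measurableT_comp mg); exact: measurable_scale_shift_comp.
    apply: (etrans (IH (s - t)%R (fun x => g (scale_shift t x v)) mgv
      (fun _ => g0 _))).
    apply: (congr1 (fun z => C * z)).
    pose f z := g z * (cone q (s - t)
      (scale_shift (-1) z (scale_shift t (zero_tuple m) v)))%:E.
    have mf : measurable_fun setT f.
      exact: (measurableT_comp mG3 (measurable_pair1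
        (t : mR, scale_shift t (zero_tuple m) v))).
    refine (etrans _ (ge0_integral_shift_tuple (scale_shift t (zero_tuple m) v) mf
      (fun z => G30 t _ z))).
    apply: eq_integral => x _.
    have e1 : scale_shift 1 (scale_shift t (zero_tuple m) v) x = scale_shift t x v.
      by apply: eq_from_tnth => i; rewrite !tnth_mktuple addr0 mul1r addrC.
    have e2 : scale_shift (-1) (scale_shift t x v) (scale_shift t (zero_tuple m) v)
      = x.
      by apply: eq_from_tnth => i; rewrite !tnth_mktuple; ring.
    by rewrite /f e1 e2.
  have mGt : measurable_fun setT (G t)
    by exact: (measurableT_comp mG (measurable_pair1 (t : mR))).
  have mGv : measurable_fun setT (fun v => G t (scale_shift t (zero_tuple m) v)).
    by apply: (measurableT_comp mGt); exact: measurable_scale_shift.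
  refine (etrans (congr1 (fun z => (ppow a t)%:E * z) (@ge0_integralZl _ _ _ rho setT
    measurableT _ mGv C (fun _ _ => G0 _ _) C0)) _).
  rewrite muleCA; apply: (congr1 (fun z => C * z)).
  exact: (integral_one_step t mGt (G0 t)).
have mGc : measurable_fun setT (fun w :
  mR * m.-tuple mR => G w.1 w.2 * (cone p w.1 w.2)%:E).
  apply: emeasurable_funM => //; apply/measurable_EFinP; exact: measurable_cone.
have Gc0 t y : 0 <= G t y * (cone p t y)%:E by rewrite mule_ge0// lee_fin cone_ge0.
under eq_integral do rewrite muleA.
rewrite ge0_integralZl//; last 3 first.
- exact: (measurable_fun_ge0_integral (leb m) mGc).
- by move=> t _; exact: integral_ge0.
- exact: mule_ge0.
rewrite -(muleA C K) -(muleA C (K * _)) -(muleA K); congr (_ * (_ * _)).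
have mH3 : measurable_fun setT (fun w : (mR * m.-tuple mR) * m.-tuple mR =>
    g w.1.2 * (cone p w.1.1 w.2 * cone q (s - w.1.1)
      (scale_shift (-1) w.1.2 w.2))%:E).
  apply: emeasurable_funM; first by apply: (measurableT_comp mg);
    exact: (measurableT_comp measurable_snd).
  have m1 : measurable_fun setT (fun w : (mR * m.-tuple mR) * m.-tuple mR => w.1.1).
    exact: (measurableT_comp measurable_fst).
  apply/measurable_EFinP; apply: measurable_funM; apply: measurable_cone => //.
    exact: measurable_funB.
  by apply: measurable_scale_shift_comp => //;
    exact: (measurableT_comp measurable_snd).
have H30 w y : 0 <= g w.2 * (cone p w.1 y * cone q (s - w.1)
  (scale_shift (-1) w.2 y))%:E.
  by rewrite mule_ge0// lee_fin mulr_ge0// cone_ge0.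
transitivity (\int[mu]_t \int[leb m]_z \int[leb m]_y
    (g z * (cone p t y * cone q (s - t) (scale_shift (-1) z y))%:E)).
  apply: eq_integral => t _.
  rewrite (ge0_integral_swap (leb m) (leb m)
    (f := fun z y => g z * (cone p t y * cone q (s - t)
      (scale_shift (-1) z y))%:E))//; last 2 first.
  - apply: (measurableT_comp mH3 (g := fun w :
      m.-tuple mR * m.-tuple mR => ((t : mR, w.1), w.2))).
    by apply: measurable_fun_pair => //; apply: measurable_fun_pair.
  - by move=> z y; exact: (H30 (t, z)).
  apply: eq_integral => y _; rewrite muleC -ge0_integralZl//; last 2 first.
  - exact: (measurableT_comp mG3 (measurable_pair1 (t : mR, y))).
  - by rewrite lee_fin cone_ge0.
  by apply: eq_integral => z _; rewrite muleCA EFinM.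
rewrite (ge0_integral_swap mu (leb m) (f := fun t z => \int[leb m]_y
    (g z * (cone p t y * cone q (s - t) (scale_shift (-1) z y))%:E)))//; last 2 first.
- exact: (measurable_fun_ge0_integral (leb m) mH3).
- by move=> t z; apply: integral_ge0 => y _; exact: (H30 (t, z)).
rewrite -ge0_integralZl//; last 3 first.
- by apply: emeasurable_funM => //; apply/measurable_EFinP; exact: measurable_cone.
- by move=> z _; rewrite mule_ge0// lee_fin cone_ge0.
- exact: riesz_constant_ge0.
apply: eq_integral => z _.
have mcc : measurable_fun setT (fun w : mR * m.-tuple mR =>
    (cone p w.1 w.2 * cone q (s - w.1) (scale_shift (-1) z w.2))%:E).
  apply/measurable_EFinP; apply: measurable_funM; apply: measurable_cone => //.
    exact: measurable_funB.
  exact: measurable_scale_shift_comp.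
have cc0 t y : 0 <= (cone p t y * cone q (s - t) (scale_shift (-1) z y))%:E.
  by rewrite lee_fin mulr_ge0// cone_ge0.
rewrite muleCA -conv_exponentS -riesz_convolution -ge0_integralZl//; last 2 first.
- exact: (measurable_fun_ge0_integral (leb m) mcc).
- by move=> t _; exact: integral_ge0.
apply: eq_integral => t _; rewrite ge0_integralZl//.
exact: (measurableT_comp mcc (measurable_pair1 (t : mR))).
Qed.

End convolution.

(** * Joint laws from independence *)
Section independent_law.
Context d (T : measurableType d) d' (S : measurableType d') (R : realType).
Variable rho : probability S R.
Local Open Scope ereal_scope.

(** A finite measure under which the [Z i] factorise with common law [rho]
    pushes forward to a multiple of the product law. *)
Lemma factor_iid n (nu : {measure set T -> \bar R}) (Z : 'I_n -> T -> S) :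
  nu setT < +oo -> (forall i, measurable_fun setT (Z i)) ->
  (forall B : 'I_n -> set S, (forall i, measurable (B i)) ->
    nu [set w | forall i, B i (Z i w)] = nu setT * \prod_(i < n) rho (B i)) ->
  forall B, measurable B ->
    nu ((fun w => [tuple Z i w | i < n]) @^-1` B) = nu setT * iid rho n B.
Proof.
elim: n nu Z => [|n IH] nu Z nuT mZ H B mB.
  have -> : (fun w => [tuple Z i w | i < 0]) @^-1` B = [set w : T | B [tuple]].
    by apply/seteqP; split => w /=; rewrite (tuple0 [tuple Z i w | i < 0]).
  have [b|b] := pselect (B [tuple]).
    have -> : [set w : T | B [tuple]] = setT by apply/seteqP; split.
    by rewrite /= diracE mem_set// mule1.
  have -> : [set w : T | B [tuple]] = set0 by apply/seteqP; split.
  by rewrite /= diracE memNset// mule0 measure0.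
pose W (w : T) := [tuple Z (lift ord0 i) w | i < n].
have mW : measurable_fun setT W.
  apply/measurable_fun_tnthP => i.
  by rewrite (_ : _ \o _ = Z (lift ord0 i))//; apply/funext => w /=;
    rewrite tnth_mktuple.
pose V (w : T) := (Z ord0 w, W w).
have mV : measurable_fun setT V by apply: measurable_fun_pair.
have ZW w : [tuple Z i w | i < n.+1] = tuple_cons (V w).
  apply: eq_from_tnth => i; rewrite tnth_mktuple.
  by case: (unliftP ord0 i) => [j ->|->]; rewrite ?tnth0// tnthS tnth_mktuple.
have nufin : nu setT \is a fin_num by rewrite ge0_fin_numE.
have r0 : (0 <= fine (nu setT))%R by rewrite fine_ge0.
have rect A C : measurable A -> measurable C ->
    nu (V @^-1` (A `*` C)) = nu setT * (rho A * iid rho n C).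
  move=> mA mC.
  have mD : measurable (Z ord0 @^-1` A) by rewrite -[X in measurable X]setTI;
    exact: mZ.
  have nuD B' : (forall i, measurable (B' i)) ->
    nu ([set w | forall i, B' i (Z (lift ord0 i) w)] `&` Z ord0 @^-1` A)
      = nu setT * rho A * \prod_(i < n) rho (B' i).
    move=> mB'.
    have := H (fun i => if unlift ord0 i is Some j then B' j else A).
    rewrite big_ord_recl unlift_none muleA.
    under eq_bigr do rewrite liftK.
    move=> <-; last by move=> i; case: unliftP => [j _|_]; [exact: mB'|].
    congr (nu _); apply/seteqP; split => w /=.
      by move=> [h1 h2] i; case: unliftP => [j ->|->].
    move=> h; split => [i|].
      by have := h (lift ord0 i); rewrite liftK.
    by have := h ord0; rewrite unlift_none.
  have nuA : mrestr nu mD setT = nu setT * rho A.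
    have := nuD (fun _ => setT) (fun _ => measurableT).
    rewrite big1; last by move=> i _; exact: probability_setT.
    by rewrite mule1 => <-; congr (nu (_ `&` _)); apply/seteqP; split.
  transitivity (mrestr nu mD (W @^-1` C)).
    by rewrite /mrestr setIC.
  rewrite (IH (mrestr nu mD : {measure set T -> \bar R}))//.
  - by rewrite -[X in X * _ = _]/(mrestr nu mD setT) nuA muleA.
  - apply: (@le_lt_trans _ _ (nu setT)) => //.
    by apply: le_measure; rewrite ?inE//; exact: measurableI.
  - by move=> B' mB'; rewrite -[X in _ = X * _]/(mrestr nu mD setT) nuA -nuD.
(* Two finite measures on the product that agree on rectangles; the induction
   hypothesis is applied to the restriction of [nu] to [Z ord0 @^-1` A]. *)
pose m1 : {measure set (S * n.-tuple S) -> \bar R} := pushforward nu V.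
pose m2 : {measure set (S * n.-tuple S) -> \bar R} :=
  mscale (NngNum r0) (rho \x iid rho n).
have e : m1 mV (@tuple_cons _ S n @^-1` B) = m2 (@tuple_cons _ S n @^-1` B).
  apply: (@measure_unique _ R (S * n.-tuple S)%type
    [set X | exists A C, [/\ measurable A, measurable C & X = A `*` C]]
    (fun _ => setT) _ _ _ _ (m1 mV) m2) => //.
  - rewrite measurable_prod_measurableType; congr (<<s _ >>).
    apply/seteqP; split => [X [A mA [C mC <-]]|X [A [C [mA mC ->]]]].
      by exists A, C.
    by exists A => //; exists C.
  - move=> _ _ [A [C [mA mC ->]]] [A' [C' [mA' mC' ->]]].
    exists (A `&` A'), (C `&` C'); split; [exact: measurableI|exact: measurableI|].
    by rewrite setXI.
  - by move=> _; exists setT, setT; rewrite setXTT.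
  - by rewrite bigcup_const//; exists 0%N.
  - move=> _ [A [C [mA mC ->]]].
    rewrite /m1/= /pushforward rect// /m2 /= /mscale/= fineK//.
    by rewrite product_measure1E.
  - by rewrite -[X in measurable X]setTI; exact: measurable_tuple_cons.
transitivity (m1 mV (@tuple_cons _ S n @^-1` B)).
  by congr (nu _); apply/seteqP; split => w /=; rewrite ZW.
by rewrite e /m2 /= /mscale/= fineK.
Qed.

(** The joint law of [X] and of the tuple of the [Z i] is a product law if [X]
    and the [Z i] are independent and the [Z i] have the common law [rho]. *)
Lemma ge0_expectation_iid (P : probability T R) dX (U : measurableType dX)
    (X : {mfun T >-> U}) n (Z : 'I_n -> T -> S) (g : U -> n.-tuple S -> \bar R) :
  (forall i, measurable_fun setT (Z i)) ->
  (forall (A : set U) (B : 'I_n -> set S), measurable A ->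
    (forall i, measurable (B i)) ->
    P ([set w | forall i, B i (Z i w)] `&` X @^-1` A) = P (X @^-1` A)
      * \prod_(i < n) rho (B i)) ->
  measurable_fun setT (fun z : U * n.-tuple S => g z.1 z.2) ->
    (forall u s, 0 <= g u s) ->
  \int[P]_w g (X w) [tuple Z i w | i < n]
  = \int[distribution P X]_u \int[iid rho n]_s g u s.
Proof.
move=> mZ H mg g0.
have mX : measurable_fun setT X by [].
pose W (w : T) := [tuple Z i w | i < n].
have mW : measurable_fun setT W.
  apply/measurable_fun_tnthP => i.
  by rewrite (_ : _ \o _ = Z i)//; apply/funext => w /=; rewrite tnth_mktuple.
pose V (w : T) := (X w, W w).
have mV : measurable_fun setT V by apply: measurable_fun_pair.
pose m1 : {measure set (U * n.-tuple S) -> \bar R} := pushforward P V.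
rewrite -(ge0_integral_prod (distribution P X) (iid rho n) mg g0).
transitivity (\int[m1 mV]_z g z.1 z.2).
  by rewrite [RHS](ge0_integral_pushforward mV)// => z _; exact: g0.
apply: eq_measure_integral => E mE _; apply/esym; apply: product_measure_unique => //.
move=> A B mA mB.
have mD : measurable (X @^-1` A) by rewrite -[X in measurable X]setTI; exact: mX.
have PT : mrestr P mD setT = P (X @^-1` A) by rewrite /mrestr setTI.
transitivity (mrestr P mD (W @^-1` B)); first by rewrite /mrestr setIC.
rewrite (factor_iid (nu := (mrestr P mD : {measure set T -> \bar R})))//.
- by rewrite -[X in X * _ = _]/(mrestr P mD setT) PT.
- by rewrite -[X in X < _]/(mrestr P mD setT) PT
    (le_lt_trans (probability_le1 _ _))// ltry.
- by move=> B' mB'; rewrite -[X in _ = X * _]/(mrestr P mD setT) PT -H.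
Qed.

End independent_law.

(** * The Gamma function *)
Section gamma.
Context {R : realType}.
Local Notation mR := (measurableTypeR R).
Local Notation mu := (@lebesgue_measure R).
Local Notation leb := (lebesgue_tuple R).
Local Open Scope ereal_scope.

(** Euler's integral as an extended real number, defined whether or not it
    converges. *)
Definition eGamma (x : R) : \bar R := \int[mu]_u (ppow (x - 1) u * expR (- u))%:E.

Lemma eGamma_ge0 x : 0 <= eGamma x.
Proof. by apply: integral_ge0 => u _;
  rewrite lee_fin mulr_ge0 ?ppow_ge0// expR_ge0. Qed.

Lemma Gamma_eGamma x : Gamma x = fine (eGamma x).
Proof.
rewrite /Gamma /Rintegral /eGamma; congr fine.
rewrite [LHS](integral_mkcond_bool _ (b := fun u : mR => 0 < u)%R); last first.
  by move=> u; rewrite /= in_itv/= andbT.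
by apply: eq_integral => u _; rewrite /ppow; case: ifP => //; rewrite mul0r.
Qed.

Lemma Gamma_ge0 (x : R) : (0 <= Gamma x)%R.
Proof. by rewrite Gamma_eGamma fine_ge0// eGamma_ge0. Qed.

Lemma measurable_expRN d (T : measurableType d) (f : T -> R) :
  measurable_fun setT f -> measurable_fun setT (fun w => expR (- f w)).
Proof.
move=> mf; apply: (measurableT_comp (@measurable_expR R)).
exact: measurable_funN.
Qed.

Lemma integral_tuple_gauss n :
  \int[leb n]_y (expR (- sqnorm y))%:E = (Num.sqrt pi ^+ n)%:E.
Proof.
have m k : measurable_fun setT (fun y : k.-tuple mR => (expR (- sqnorm y))%:E).
  by apply/measurable_EFinP; apply: measurable_expRN; exact: measurable_sqnorm.
elim: n => [|n IH].
  by rewrite integral_lebesgue_tuple0 /sqnorm big_ord0 oppr0 expR0 expr0.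
rewrite integral_lebesgue_tupleS//.
transitivity (\int[mu]_x ((gauss_fun x)%:E * (Num.sqrt pi ^+ n)%:E)).
  apply: eq_integral => x _; rewrite -IH -ge0_integralZl//; last 2 first.
  - exact: m.
  - by rewrite lee_fin gauss_fun_ge0.
  by apply: eq_integral => y _; rewrite sqnorm_cons opprD expRD.
rewrite ge0_integralZr//; last 2 first.
- by apply/measurable_EFinP; exact: measurable_gauss_fun.
- by move=> x _; rewrite lee_fin gauss_fun_ge0.
by rewrite integralT_gauss -EFinM exprS.
Qed.

(** Both sides are the integral of [(w - |y|^2)_+^p exp(-w)] over [w] and [y],
    integrated in the two possible orders. *)
Lemma gamma_ball n p :
  eGamma (p + 1) * (Num.sqrt pi ^+ n)%:E = eGamma (p + 1 + n%:R / 2) * ball_integral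
    n p.
Proof.
have mf : measurable_fun setT (fun z : n.-tuple mR * mR =>
    (ppow p (z.2 - sqnorm z.1) * expR (- z.2))%:E).
  apply/measurable_EFinP; apply: measurable_funM; last exact: measurable_expRN.
  apply: measurable_ppow_comp; apply: measurable_funB => //.
  exact: (measurableT_comp (@measurable_sqnorm R n)).
have f0 (y : n.-tuple mR) (w : mR) : 0 <= (ppow p (w - sqnorm y) * expR (- w))%:E.
  by rewrite lee_fin mulr_ge0 ?ppow_ge0// expR_ge0.
transitivity (\int[leb n]_y \int[mu]_w (ppow p (w - sqnorm y) * expR (- w))%:E).
  rewrite -integral_tuple_gauss -ge0_integralZl//; last 2 first.
  - by apply/measurable_EFinP; apply: measurable_expRN; exact: measurable_sqnorm.
  - exact: eGamma_ge0.
  apply: eq_integral => y _.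
  have mfy := measurableT_comp mf (measurable_pair1 y).
  have mg : measurable_fun setT (fun u : mR => (ppow (p + 1 - 1) u * expR (- u))%:E).
    by apply/measurable_EFinP; apply: measurable_funM;
      [exact: measurable_ppow|exact: measurable_expRN].
  have g0 u : setT u -> 0 <= (ppow (p + 1 - 1) u * expR (- u))%:E.
    by move=> _; rewrite lee_fin mulr_ge0 ?ppow_ge0// expR_ge0.
  have e0 : 0 <= (expR (- sqnorm y))%:E by rewrite lee_fin expR_ge0.
  refine (etrans (esym (@ge0_integralZr _ _ _ mu setT measurableT _ mg _ g0 e0)) _).
  refine (etrans _ (ge0_integral_shift (sqnorm y) mfy (f0 y))).
  by apply: eq_integral => u _ /=; rewrite -EFinM !addrK opprD expRD mulrA.
rewrite (ge0_integral_swap (leb n) mu mf f0) /eGamma.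
rewrite -ge0_integralZr//; last 3 first.
- by apply/measurable_EFinP; apply: measurable_funM;
    [exact: measurable_ppow|exact: measurable_expRN].
- by move=> u _; rewrite lee_fin mulr_ge0 ?ppow_ge0// expR_ge0.
- exact: ball_integral_ge0.
apply: eq_integral => w _.
transitivity ((expR (- w))%:E * \int[leb n]_y (ppow p (w - 1 * sqnorm y))%:E).
  rewrite -[RHS]ge0_integralZl//; last 2 first.
  - apply/measurable_EFinP; apply: measurable_ppow_comp; apply: measurable_funB => //.
    by apply: measurable_funM => //; exact: measurable_sqnorm.
  - by move=> y _; rewrite lee_fin ppow_ge0.
  by apply: eq_integral => y _; rewrite -EFinM mul1r mulrC.
rewrite integral_ball_scaled// powR1 mul1r muleCA [RHS]muleC; congr (_ * _).
by rewrite -EFinM mulrC; congr ((ppow _ _ * _)%:E); ring.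
Qed.

(** The integrand is bounded by a multiple of the exponential density of
    parameter 1/2. *)
Lemma eGamma_lty (q : R) : (0 <= q)%R -> eGamma (q + 1) < +oo.
Proof.
move=> q0; pose M := (2 * expR (q * ln (2 * q)))%R.
have m : measurable_fun setT (fun u : mR => (exponential_pdf 2^-1 u)%:E).
  by apply/measurable_EFinP; exact: measurable_exponential_pdf.
apply: (@le_lt_trans _ _ (\int[mu]_u (M%:E * (exponential_pdf 2^-1 u)%:E))).
  apply: ge0_le_integral => //.
  - by move=> u _; rewrite lee_fin mulr_ge0 ?ppow_ge0// expR_ge0.
  - by apply/measurable_EFinP; apply: measurable_funM;
      [exact: measurable_ppow|exact: measurable_expRN].
  - exact: measurable_funeM.
  move=> u _; rewrite -EFinM lee_fin addrK.
  have [u0|u0] := leP u 0%R.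
    rewrite ppow_le0// mul0r mulr_ge0//; first by rewrite mulr_ge0// expR_ge0.
    by apply: exponential_pdf_ge0; rewrite invr_ge0.
  rewrite ppow_gt0// exponential_pdfE; last exact: ltW.
  rewrite /M mulrACA mulfV// mul1r mulNr (mulrC 2^-1%R).
  rewrite /powR (gt_eqF u0) -!expRD ler_expR.
  have [->|qn] := eqVneq q 0%R; first by rewrite !mul0r; lra.
  have qp : (0 < q)%R by rewrite lt_neqAle eq_sym qn.
  have e : (q * ln u = q * ln (2 * q) + q * ln (u / (2 * q)))%R.
    rewrite -mulrDr -lnM ?posrE ?divr_gt0 ?mulr_gt0//.
    by rewrite [(2 * q * _)%R]mulrC divfK// gt_eqF// mulr_gt0.
  (* [q ln u <= q ln (2 q) + u / 2] is [ln x < x] at [x = u / (2 q)]. *)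
  have := ln_sublinear (divr_gt0 u0 (mulr_gt0 (ltr0n R 2) qp)).
  rewrite -(ltr_pM2l qp) e (_ : q * (u / (2 * q)) = u / 2)%R; last by field.
  lra.
rewrite ge0_integralZl//; last 2 first.
- by move=> u _; rewrite lee_fin; apply: exponential_pdf_ge0; rewrite invr_ge0.
- by rewrite lee_fin mulr_ge0// expR_ge0.
by rewrite integral_exponential_pdf ?invr_gt0// mule1 ltry.
Qed.

(** On (1, 2) the integrand is at least [exp(-2)]. *)
Lemma eGamma_gt0 (q : R) : (0 <= q)%R -> 0 < eGamma (q + 1).
Proof.
move=> q0; apply: (@lt_le_trans _ _ (\int[mu]_(u in `]1%R, 2%R[) (expR (- 2))%:E)).
  rewrite integral_cst//= lebesgue_measure_itv/= lte_fin ltr1n -EFinD -EFinM lte_fin.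
  by rewrite mulr_gt0 ?expR_gt0//; lra.
rewrite [leLHS](integral_mkcond_bool _ (b := fun u : mR => 1 < u < 2)%R); last first.
  by move=> u; rewrite /= in_itv/=.
apply: ge0_le_integral => //.
- by move=> u _; case: ifP => // _; rewrite lee_fin expR_ge0.
- apply: (@measurable_fun_ifT _ _ mR (\bar R) (cst (expR (- 2))%:E) (cst 0)
    (fun u => 1 < u < 2)%R).
  + exact: measurable_between.
  + exact: measurable_cst.
  + exact: measurable_cst.
- by apply/measurable_EFinP; apply: measurable_funM;
    [exact: measurable_ppow|exact: measurable_expRN].
move=> u _; rewrite addrK; case: ifP => [/andP[u1 u2]|_]; last first.
  by rewrite lee_fin mulr_ge0 ?ppow_ge0// expR_ge0.
have u0 : (0 < u)%R by rewrite (lt_trans _ u1).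
rewrite lee_fin ppow_gt0// /powR gt_eqF// -expRD ler_expR.
have : (0 <= q * ln u)%R by rewrite mulr_ge0// ln_ge0// ltW.
lra.
Qed.

End gamma.

(** * The densities of the random flight *)
Section flight.
Context {R : realType}.
Local Notation mR := (measurableTypeR R).
Local Notation leb := (lebesgue_tuple R).

Lemma enormE m (x : m.-tuple mR) : enorm x ^+ 2 = sqnorm x.
Proof. by rewrite /enorm sqr_sqrtr// sqnorm_ge0. Qed.

Lemma enorm_lt m (x : m.-tuple mR) (r : R) :
  0 < r -> (enorm x < r) = (sqnorm x < r ^+ 2).
Proof.
move=> r0; rewrite -enormE; apply/idP/idP => h.
  by rewrite ltr_pXn2r// nnegrE ?sqrtr_ge0// ltW.
by rewrite -(@ltr_pXn2r _ 2)// nnegrE ?sqrtr_ge0// ltW.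
Qed.

(** The truncated powers account for the support of the density. *)
Lemma duration_densityE d n (nu t : R) (u : n.-tuple mR) :
  let a := 2 * nu + d%:R - 1 in
  duration_density d nu t u =
  Gamma (n.+1%:R * a) / Gamma a ^+ n.+1 / t `^ (n.+1%:R * a - 1) *
  duration_weight (2 * nu + d%:R - 2) t u.
Proof.
move=> a; rewrite /duration_density -/a.
have durE (k : 'I_n.+1) : tnth (durations t u) k =
    if (k < n)%N then nth 0 u k else t - \sum_(x <- u) x.
  rewrite (tnth_nth 0) /= nth_rcons size_tuple.
  by case: ltnP => // kn; rewrite eqn_leq kn -ltnS ltn_ord.
case: ifPn => [/andP[/allP up su]|H].
  rewrite -[in RHS]mulrA; congr (_ * _); rewrite mulrC; congr (_ * _).
  apply: eq_bigr => k _; rewrite ppow_gt0// durE; case: ltnP => [kn|_];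
    last by rewrite subr_gt0.
  by rewrite up// mem_nth// size_tuple.
apply/esym/eqP; rewrite mulf_eq0; apply/orP; right.
suff [k uk] : exists k : 'I_n.+1, tnth (durations t u) k <= 0.
  by rewrite /duration_weight (bigD1 k)//= ppow_le0// mul0r.
move: H; rewrite negb_and => /orP[/allPn[x xu x0]|su]; last first.
  by exists ord_max; rewrite durE ltnn subr_le0 leNgt.
have xn : (index x u < n)%N by rewrite -[X in (_ < X)%N](size_tuple u) index_mem.
exists (widen_ord (leqnSn n) (Ordinal xn)); rewrite durE /= xn nth_index//.
by rewrite leNgt.
Qed.

Lemma angle_densityE D (nu : R) (th : D.+1.-tuple mR) :
  @angle_density R D.+2 nu th =
  Gamma (nu + D.+2%:R / 2) / (2 * pi `^ ((D.+2%:R - 1) / 2) * Gamma (nu + 1 / 2)) *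
  angle_weight nu th.
Proof.
rewrite /angle_density /angle_weight /=; case: ifP => _; last by rewrite mulr0.
rewrite -!mulrA; congr (_ * (_ * _)); congr (_ * _).
apply: eq_bigr => j _; congr (_ `^ _); rewrite -[D.+2%:R]natr1 -[D.+1%:R]natr1; ring.
Qed.

Lemma flight_coordE d n m (c t : R) (u : n.-tuple mR)
  (th : 'I_n.+1 -> d.-1.-tuple mR) :
  [tuple flight_coord c t u th i | i < m] =
  scale_shift c (zero_tuple m) (lincomb (durations t u)
    [tuple direction m (th k) | k < n.+1]).
Proof.
apply: eq_from_tnth => i; rewrite !tnth_mktuple addr0 /flight_coord; congr (_ * _).
by apply: eq_bigr => k _; rewrite !tnth_mktuple mulrA.
Qed.

(** Independence of the durations and of the angles of the segments, as a
    product rule on rectangles. *)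
Lemma flight_factor disp (T : measurableType disp) (P : probability T R) d n
    (tau : {RV P >-> n.-tuple mR}) (theta : 'I_n.+1 -> {RV P >-> d.-tuple mR})
    (A : set (n.-tuple mR)) (B : 'I_n.+1 -> set (d.-tuple mR)) :
  mutually_independent P (@flight_algebras _ _ _ P d.+1 n tau theta) ->
  measurable A -> (forall k, measurable (B k)) ->
  (P ([set w | forall k, B k (theta k w)] `&` tau @^-1` A) =
   P (tau @^-1` A) * \prod_(k < n.+1) P (theta k @^-1` B k))%E.
Proof.
move=> ind mA mB.
pose E (o : option 'I_n.+1) := if o is Some k then theta k @^-1` B k else tau @^-1` A.
have EF i : i \in (finset.setTfor (option 'I_n.+1)) ->
  @flight_algebras _ _ _ P d.+1 n tau theta i (E i).
  case: i => [k|] _ /=; rewrite /g_sigma_algebra_preimage /preimage_set_system/=.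
    by exists (B k) => //; rewrite setTI.
  by exists A => //; rewrite setTI.
have := ind _ _ EF.
rewrite (_ : \bigcap_(i in _) _ = [set w | forall k, B k (theta k w)] `&` tau @^-1`
  A); last first.
  apply/seteqP; split => w /=.
    move=> h; split => [k|]; first by apply: (h (Some k)); rewrite /= inE.
    by apply: (h None); rewrite /= inE.
  by move=> [h1 h2] [k|] _ /=; [exact: h1|].
move=> ->; rewrite (bigD1 None) ?inE//=; congr (_ * _)%E.
rewrite (reindex_onto Some (odflt ord0))/=; last by move=> [k|]//; rewrite andbF.
by apply: eq_bigl => k; rewrite inE eqxx.
Qed.

Lemma eGamma_Gamma (q : R) : 0 <= q -> eGamma (q + 1) = (Gamma (q + 1))%:E.
Proof.
by move=> q0; rewrite Gamma_eGamma fineK// ge0_fin_numE ?eGamma_lty// eGamma_ge0.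
Qed.

Lemma Gamma_gt0 (q : R) : 0 <= q -> 0 < Gamma (q + 1).
Proof. by move=> q0; rewrite -lte_fin -eGamma_Gamma// eGamma_gt0. Qed.

(** The hypotheses force [B], and then [K], to be finite. *)
Lemma ereal_constant (K B : \bar R) (g1 g2 a s : R) :
  0 < g1 -> 0 < g2 -> 0 < a -> 0 < s ->
  (g1%:E * a%:E = g2%:E * B)%E -> (K * (B * s%:E) = 1)%E ->
  K = (g2 / (g1 * (a * s)))%:E.
Proof.
move=> g10 g20 a0 s0.
have nt (x : R) : 0 < x -> x != 0 by move=> /lt0r_neq0.
case: B => [b| |]; last 2 first.
- by rewrite gt0_muley ?lte_fin.
- by rewrite gt0_muleNy ?lte_fin.
rewrite -!EFinM => -[e].
have -> : b = g1 * a / g2 by rewrite e mulrAC mulfV ?mul1r ?nt.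
have c0 : 0 < g1 * a / g2 * s by rewrite !mulr_gt0// invr_gt0.
case: K => [k| |]; last 2 first.
- by rewrite gt0_mulye ?lte_fin.
- by rewrite gt0_mulNye ?lte_fin.
rewrite -EFinM => -[h]; congr EFin; apply: (mulIf (nt _ c0)); rewrite h.
by field; rewrite !nt.
Qed.

(** A probability density proportional to a truncated power of
    [r^2 - |x|^2] has the explicit constant. *)
Lemma ball_density_constant m q (r : R) (K : \bar R) : 0 < r -> 0 <= q ->
  (K * \int[leb m]_x (ppow q (r ^+ 2 - sqnorm x))%:E = 1)%E ->
  K = (Gamma (q + 1 + m%:R / 2) /
    (Gamma (q + 1) * (pi `^ (m%:R / 2) * r `^ (2 * q + m%:R))))%:E.
Proof.
move=> r0 q0.
have -> : (\int[leb m]_x (ppow q (r ^+ 2 - sqnorm x))%:E = ball_integral m q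
  * (r `^ (2 * q + m%:R))%:E)%E.
  transitivity (\int[leb m]_x (ppow q (r ^+ 2 - 1 * sqnorm x))%:E)%E.
    by apply: eq_integral => x _; rewrite mul1r.
  rewrite integral_ball_scaled// powR1 mul1r ppow_gt0 ?exprn_gt0//.
  rewrite -[r ^+ 2]powR_mulrn ?ltW// -powRrM.
  by congr (_ * (_ `^ _)%:E)%E; field.
have q20 : 0 <= q + m%:R / 2 by rewrite addr_ge0// divr_ge0.
have pe : pi `^ (m%:R / 2) = Num.sqrt pi ^+ m :> R.
  by rewrite -powR12_sqrt ?pi_ge0// -powR_mulrn ?powR_ge0// -powRrM mulrC.
apply: ereal_constant.
- exact: Gamma_gt0.
- by rewrite addrAC Gamma_gt0.
- by rewrite powR_gt0 ?pi_gt0.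
- exact: powR_gt0.
- by rewrite addrAC -!eGamma_Gamma// pe gamma_ball addrAC.
Qed.

End flight.

Lemma measurable_angle_density (R : realType) D (nu : R) :
  measurable_fun setT (@angle_density R D.+2 nu :
    D.+1.-tuple (measurableTypeR R) -> R).
Proof.
set k := Gamma (nu + D.+2%:R / 2) / (2 * pi `^ ((D.+2%:R - 1) / 2) * Gamma
  (nu + 1 / 2)).
rewrite (_ : @angle_density R D.+2 nu = fun th : D.+1.-tuple (measurableTypeR R) =>
    k * angle_weight nu th); last first.
  by apply/funext => th; rewrite angle_densityE.
by apply: measurable_funM => //; exact: measurable_angle_weight.
Qed.

Lemma measurable_duration_density (R : realType) d n (nu t : R) :
  measurable_fun setT (@duration_density R d n nu t).
Proof.
pose a := 2 * nu + d%:R - 1.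
rewrite (_ : @duration_density R d n nu t = fun u : n.-tuple (measurableTypeR R) =>
    Gamma (n.+1%:R * a) / Gamma a ^+ n.+1 / t `^ (n.+1%:R * a - 1) *
    duration_weight (2 * nu + d%:R - 2) t u); last first.
  by apply/funext => u; rewrite duration_densityE.
by apply: measurable_funM => //; exact: measurable_duration_weight.
Qed.

(** * The law of the projection *)
Theorem theorem2 (R : realType) (disp : measure_display)
    (T : measurableType disp) (P : probability T R)
    (d m n : nat) (nu c t : R)
    (tau : {RV P >-> n.-tuple (measurableTypeR R)})
    (theta : 'I_n.+1 -> {RV P >-> d.-1.-tuple (measurableTypeR R)})
    (hd : (2 <= d)%N) (hm : (1 <= m < d)%N) (hn : (1 <= n)%N)
    (hnu : 0 <= nu) (hc : 0 < c) (ht : 0 < t)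
    (htau : has_density (distribution P tau) (@duration_density R d n nu t))
    (htheta : forall k,
      has_density (distribution P (theta k)) (@angle_density R d nu))
    (hind : mutually_independent P (flight_algebras tau theta)) :
  distribution P (flight_projection m c t tau theta)
    [set x | enorm x < c * t] = 1%E /\
  has_density (distribution P (flight_projection m c t tau theta))
    (@projection_density R d m n nu c t).
Proof.
case: d theta hd hm htau htheta hind => [//|[//|D]] theta _ /andP[].
case: m => [//|N] _ mD htau htheta hind; rewrite ltnS in mD.
set m := N.+1 in mD *.
set X := flight_projection m c t tau theta.
pose mR := measurableTypeR R.
pose leb := lebesgue_tuple R.
pose p := nu + (D%:R - m%:R) / 2.
have aE : 2 * nu + D.+2%:R - 2 = 2 * p + m%:R.
  by rewrite /p -natr1 -natr1; field.
have [K K0 KE] := angle_projection hnu mD.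
pose k1 := Gamma (nu + D.+2%:R / 2) /
  (2 * pi `^ ((D.+2%:R - 1) / 2) * Gamma (nu + 1 / 2)).
have k10 : 0 <= k1 by rewrite divr_ge0 ?mulr_ge0 ?powR_ge0 ?Gamma_ge0.
pose V k (w : T) : m.-tuple mR := direction m (theta k w).
have mV k : measurable_fun setT (V k).
  by apply: (measurableT_comp (@measurable_direction R D.+1 m)).
have mdir (B : set (m.-tuple mR)) : measurable B ->
    measurable ((direction m : D.+1.-tuple mR -> _) @^-1` B).
  by move=> mB; rewrite -[X in measurable X]setTI; exact: measurable_direction.
pose V0 : {mfun T >-> m.-tuple mR} :=
  HB.pack (V ord0) (isMeasurableFun.Build _ _ _ _ _ (mV ord0)).
(* The law of one projected direction, the same for all segments. *)
pose rho : probability (m.-tuple mR) R := distribution P V0.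
have rhoV k B : measurable B -> P (V k @^-1` B) = rho B.
  by move=> mB; rewrite [LHS](htheta k _ (mdir _ mB))
    [RHS](htheta ord0 _ (mdir _ mB)).
have kK0 : (0 <= k1%:E * K)%E by rewrite mule_ge0// lee_fin.
have rhoE (g : m.-tuple mR -> \bar R) :
  measurable_fun setT g -> (forall v, 0 <= g v)%E ->
    (\int[rho]_v g v = k1%:E * K * \int[leb m]_v
      (g v * (ppow p (1 - sqnorm v))%:E))%E.
  move=> mg g0.
  have mgd : measurable_fun setT (fun th : D.+1.-tuple mR => g (direction m th)).
    by apply: (measurableT_comp mg); exact: measurable_direction.
  transitivity (\int[distribution P (theta ord0)]_th g (direction m th))%E.
    rewrite [LHS](ge0_integral_pushforward (mV ord0) P)//.
    by rewrite [RHS](ge0_integral_pushforward (measurable_funPT (theta ord0)) P).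
  have mad := @measurable_angle_density R D nu.
  have ad0 (th : D.+1.-tuple mR) : 0 <= @angle_density R D.+2 nu th.
    by rewrite angle_densityE mulr_ge0// angle_weight_ge0.
  rewrite (ge0_integral_density mad ad0 (htheta ord0) mgd)//.
  rewrite -muleA -KE// -ge0_integralZl//; last 2 first.
  - by apply: emeasurable_funM => //; apply/measurable_EFinP;
      exact: measurable_angle_weight.
  - by move=> th _; rewrite mule_ge0// lee_fin angle_weight_ge0.
  by apply: eq_integral => th _; rewrite angle_densityE EFinM muleCA.
have [C C0 CE] := integral_duration_weight kK0 rhoE n.
set q := conv_exponent N p n in CE.
pose a := 2 * nu + D.+2%:R - 1.
have qE : q = n.+1%:R / 2 * a - (m%:R + 1) / 2.
  by have -> : a = 2 * p + m%:R + 1 by rewrite -aE /a; ring.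
pose k2 := Gamma (n.+1%:R * a) / Gamma a ^+ n.+1 / t `^ (n.+1%:R * a - 1).
have k20 : 0 <= k2 by rewrite !divr_ge0 ?exprn_ge0 ?powR_ge0 ?Gamma_ge0.
pose Kt := (k2%:E * (C * (c `^ (- (2 * q + m%:R)))%:E))%E.
have Kt0 : (0 <= Kt)%E by rewrite !mule_ge0// lee_fin ?powR_ge0.
(* The shape of the law, up to the constant [Kt]. *)
have main A : measurable A -> distribution P X A =
    (Kt * \int[leb m]_(x in A) (ppow q ((c * t) ^+ 2 - sqnorm x))%:E)%E.
  move=> mA.
  pose g (v : m.-tuple mR) := (\1_A (scale_shift c (zero_tuple m) v))%:E : \bar R.
  have mg : measurable_fun setT g.
    apply/measurable_EFinP; apply: (measurableT_comp (measurable_indic mA)).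
    exact: measurable_scale_shift.
  have g0 v : (0 <= g v)%E by rewrite lee_fin.
  pose h (u : n.-tuple mR) (vs : n.+1.-tuple (m.-tuple mR)) :=
    g (lincomb (durations t u) vs).
  have mh : measurable_fun setT (fun z => h z.1 z.2).
    apply: (measurableT_comp mg); apply: measurable_lincomb => //.
    exact: measurable_durations.
  have h0 u vs : (0 <= h u vs)%E by exact: g0.
  transitivity (\int[P]_w h (tau w) [tuple V k w | k < n.+1])%E.
    rewrite -[LHS]/(P (X @^-1` A)) -[in LHS](setIT (X @^-1` A)) -integral_indic//;
      last first.
      by rewrite -[X in measurable X]setTI; exact: measurable_funPT.
    apply: eq_integral => w _; rewrite /h /g -flight_coordE !indicE.
    congr (_%:R%:E).
  rewrite (ge0_expectation_iid (rho := rho) mV _ mh h0); last first.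
    move=> A' B mA' mB.
    have mB' k : measurable ((direction m : D.+1.-tuple mR -> _) @^-1` B k)
      by exact: mdir.
    rewrite [LHS](flight_factor hind mA' mB'); congr (_ * _)%E.
    by apply: eq_bigr => k _; rewrite -(rhoV k).
  have mdd := @measurable_duration_density R D.+2 n nu t.
  have dd0 (u : n.-tuple mR) : 0 <= duration_density D.+2 nu t u.
    by rewrite duration_densityE mulr_ge0// duration_weight_ge0.
  have mih := measurable_fun_ge0_integral (iid rho n.+1) mh h0.
  rewrite (ge0_integral_density mdd dd0 htau mih); last by move=> u;
    exact: integral_ge0.
  rewrite /Kt -!muleA; transitivity (k2%:E * \int[leb n]_u
    ((duration_weight (2 * p + m%:R) t u)%:E *
      \int[iid rho n.+1]_vs g (lincomb (durations t u) vs)))%E.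
    rewrite -[RHS]ge0_integralZl//; last 2 first.
    - by apply: emeasurable_funM => //; apply/measurable_EFinP;
        exact: measurable_duration_weight.
    - by move=> u _; rewrite mule_ge0 ?lee_fin ?duration_weight_ge0// integral_ge0.
    by apply: eq_integral => u _; rewrite duration_densityE -/a -/k2 aE EFinM muleC
      -muleA.
  rewrite CE//; congr (_ * (_ * _))%E.
  transitivity (\int[leb m]_x ((\1_A (scale_shift c (zero_tuple m) x))%:E *
      (ppow q (t ^+ 2 - sqnorm x))%:E))%E.
    by apply: eq_integral => x _; rewrite /cone ht.
  have mA1 : measurable_fun setT (fun x : m.-tuple mR => (\1_A x)%:E : \bar R).
    exact/measurable_EFinP/measurable_indic.
  rewrite (ge0_integral_ball_scale q (t ^+ 2) hc mA1); last first.
    by move=> x; rewrite lee_fin.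
  congr (_ * _)%E; rewrite [RHS]integral_mkcond; apply: eq_integral => x _.
  by rewrite patchE indicE exprMn; case: ifPn => _; rewrite ?mul1e ?mul0e.
have ct0 : 0 < c * t by exact: mulr_gt0.
(* Two segments or more make [(n + 1) / 2 >= 1], and
   [2 nu + d - 1 >= m >= (m + 1) / 2]. *)
have q0 : 0 <= q.
  have mle : m%:R <= D.+1%:R :> R by rewrite ler_nat.
  have n2 : 1 <= n.+1%:R / 2 :> R.
    by rewrite ler_pdivlMr// mul1r ler_nat.
  have a1 : m%:R <= a by rewrite /a -natr1; lra.
  have m1 : 1 <= m%:R :> R by rewrite ler1n.
  have : m%:R <= n.+1%:R / 2 * a by rewrite (le_trans a1)// ler_peMl//; lra.
  by rewrite qE; lra.
have KtE := ball_density_constant ct0 q0.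
(* The total mass determines the constant. *)
have tot := main setT measurableT; rewrite [LHS]probability_setT in tot.
have {}KtE := KtE _ _ (esym tot).
have mball : measurable [set x : m.-tuple mR | enorm x < c * t].
  rewrite (_ : [set x | _] = setT `&` [set x | sqnorm x < (c * t) ^+ 2]).
    have := @measurable_fun_ltr _ _ R setT (@sqnorm R m) (cst ((c * t) ^+ 2))
      (@measurable_sqnorm R m) (@measurable_cst _ _ _ _ _ _).
    by move=> /(_ measurableT [set true]); apply.
  by rewrite setTI; apply/seteqP; split => x /=; rewrite enorm_lt.
split.
  rewrite main// tot; congr (_ * _)%E.
  rewrite (integral_mkcond_bool _ (b := fun x : m.-tuple mR => enorm x < c * t))//.
  apply: eq_integral => x _; rewrite enorm_lt// -subr_gt0.
  by case: ltP => // x0; rewrite ppow_le0.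
move=> A mA; rewrite main// KtE -[LHS]ge0_integralZl//; last 3 first.
- apply/measurable_EFinP; apply: measurable_funTS; apply: measurable_ppow_comp.
  by apply: measurable_funB => //; exact: measurable_sqnorm.
- by move=> x _; rewrite lee_fin ppow_ge0.
- by rewrite -KtE.
apply: eq_integral => x _; rewrite -EFinM; congr EFin.
rewrite /projection_density enorm_lt// -subr_gt0 /ppow -exprMn enormE.
case: ifP => _; last by rewrite mulr0.
rewrite -/a qE; set s := n.+1%:R / 2 * a.
have -> : s - (m%:R + 1) / 2 + 1 + m%:R / 2 = s + 1 / 2 by field.
have -> : s - (m%:R + 1) / 2 + 1 = s - m%:R / 2 + 1 / 2 by field.
have -> : 2 * (s - (m%:R + 1) / 2) + m%:R = n.+1%:R * a - 1 by rewrite /s; field.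
set u := pi `^ _ * _; rewrite invfM -!mulrA; congr (_ * (_ * _)).
exact: mulrC.
Qed.
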